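(* Let $R$ be a commutative ring of Krull dimension $0$ which is integral over an Artinian subring $R_0$, write $\mathcal{F}=\mathcal{F}(R_0,R)$, and let $S=\mathcal{F}\llbracket X_1,\ldots,X_n\rrbracket$. Then $\dim S=n$. Moreover, for each $M\in\operatorname{Spec}R$, the extended ideal $MS$ is a minimal prime ideal of $S$, and $S/MS$ is a (Noetherian) regular local ring of dimension $n$.
   Context: All rings are commutative with identity, and subrings share the identity. For a $0$-dimensional ring $R$ and an Artinian subring $R_0\subseteq R$ such that $R$ is integral over $R_0$, let $\mathcal{F}(R_0,R)=\{R_\alpha\}$ denote the family of all subrings of $R$ that are finitely generated as $R_0$-algebras; this family is directed, each $R_\alpha$ is Artinian, and $R=\bigcup_\alpha R_\alpha$. The ring of Artinian power series $\mathcal{F}\llbracket X_1,\ldots,X_n\rrbracket$ is the set of all $f\in R\llbracket X_1,\ldots,X_n\rrbracket$ such that all coefficients of $f$ lie in a single $R_\alpha\in\mathcal{F}$; equivalently, $\mathcal{F}\llbracket X_1,\ldots,X_n\rrbracket=\bigcup_\alpha R_\alpha\llbracket X_1,\ldots,X_n\rrbracket$, which is a subring of $R\llbracket X_1,\ldots,X_n\rrbracket$. Dimension means Krull dimension. *)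

(* Defs.v *)
From mathcomp Require Import all_boot all_order all_algebra.
Set Implicit Arguments. Unset Strict Implicit. Unset Printing Implicit Defensive.
Import GRing.Theory.
Local Open Scope ring_scope.

(* A commutative ring presented concretely: an ambient type, a carrier
   predicate, an equality relation (the ring's equality), and operations.
   This lets us treat subrings, rings of Artinian power series and their
   quotients uniformly.  All notions below (ideal, prime, Krull dimension,
   Artinian, Noetherian, local, regular) only refer to these data. *)
Record cring := CRing {
  cr_T : Type;
  cr_car : cr_T -> Prop;
  cr_eq : cr_T -> cr_T -> Prop;
  cr_zero : cr_T;
  cr_one : cr_T;
  cr_add : cr_T -> cr_T -> cr_T;
  cr_mul : cr_T -> cr_T -> cr_T }.
Arguments cr_car : clear implicits.
Arguments cr_eq : clear implicits.
Arguments cr_zero : clear implicits.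
Arguments cr_one : clear implicits.
Arguments cr_add : clear implicits.
Arguments cr_mul : clear implicits.

Section Ideals.
Variable A : cring.
Local Notation T := (cr_T A).

Definition is_ideal (I : T -> Prop) : Prop :=
  [/\ (forall x, I x -> cr_car A x),
      (forall x y, cr_car A y -> cr_eq A x y -> I x -> I y),
      I (cr_zero A),
      (forall x y, I x -> I y -> I (cr_add A x y))
    & (forall a x, cr_car A a -> I x -> I (cr_mul A a x))].

Definition proper_ideal (I : T -> Prop) : Prop :=
  is_ideal I /\ ~ I (cr_one A).

Definition is_prime (I : T -> Prop) : Prop :=
  proper_ideal I /\
  forall a b, cr_car A a -> cr_car A b -> I (cr_mul A a b) -> I a \/ I b.

Definition is_maximal (I : T -> Prop) : Prop :=
  proper_ideal I /\
  forall J, proper_ideal J -> (forall x, I x -> J x) -> forall x, J x -> I x.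

Definition subI (I J : T -> Prop) : Prop := forall x, I x -> J x.
Definition eqI (I J : T -> Prop) : Prop := subI I J /\ subI J I.
Definition ssubI (I J : T -> Prop) : Prop := subI I J /\ exists x, J x /\ ~ I x.

Definition gen_ideal (X : T -> Prop) (x : T) : Prop :=
  forall I, is_ideal I -> (forall y, X y -> I y) -> I x.

Definition prime_chain (k : nat) (P : nat -> T -> Prop) : Prop :=
  (forall i, (i <= k)%N -> is_prime (P i)) /\
  (forall i, (i < k)%N -> ssubI (P i) (P i.+1)).

Definition krull_dim (d : nat) : Prop :=
  (exists P, prime_chain d P) /\ ~ (exists P, prime_chain d.+1 P).

Definition artinian : Prop :=
  forall I : nat -> T -> Prop, (forall i, is_ideal (I i)) ->
    (forall i, subI (I i.+1) (I i)) ->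
    exists N, forall k, (N <= k)%N -> eqI (I k) (I N).

Definition noetherian : Prop :=
  forall I : nat -> T -> Prop, (forall i, is_ideal (I i)) ->
    (forall i, subI (I i) (I i.+1)) ->
    exists N, forall k, (N <= k)%N -> eqI (I k) (I N).

Definition is_local_with (m : T -> Prop) : Prop :=
  is_maximal m /\ forall J, is_maximal J -> eqI J m.

Definition minimal_prime (P : T -> Prop) : Prop :=
  is_prime P /\ ~ (exists Q, is_prime Q /\ ssubI Q P).

Definition regular_local : Prop :=
  noetherian /\
  exists m d, is_local_with m /\ krull_dim d /\
    exists g : 'I_d -> T, (forall i, cr_car A (g i)) /\
      eqI m (gen_ideal (fun y => exists i, y = g i)).
End Ideals.
Arguments is_ideal : clear implicits.
Arguments proper_ideal : clear implicits.
Arguments is_prime : clear implicits.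
Arguments is_maximal : clear implicits.
Arguments subI : clear implicits.
Arguments eqI : clear implicits.
Arguments ssubI : clear implicits.
Arguments gen_ideal : clear implicits.
Arguments prime_chain : clear implicits.
Arguments krull_dim : clear implicits.
Arguments artinian : clear implicits.
Arguments noetherian : clear implicits.
Arguments is_local_with : clear implicits.
Arguments minimal_prime : clear implicits.
Arguments regular_local : clear implicits.

Definition ring_cr (R : comNzRingType) (P : R -> Prop) : cring :=
  @CRing R P (@eq R) 0 1 +%R *%R.

Definition subring_P (R : comNzRingType) (P : R -> Prop) : Prop :=
  [/\ P 1, (forall x y, P x -> P y -> P (x - y)) & (forall x y, P x -> P y -> P (x * y))].

Definition in_subalg (R : comNzRingType) (R0 : R -> Prop) (s : seq R) (x : R) : Prop :=
  forall P : R -> Prop, subring_P P -> (forall y, R0 y -> P y) ->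
    (forall y, y \in s -> P y) -> P x.

Definition mindex (n : nat) := {ffun 'I_n -> nat}.
Definition series (R : comNzRingType) (n : nat) := mindex n -> R.

Definition ps_zero (R : comNzRingType) n : series R n := fun _ => 0.
Definition ps_const (R : comNzRingType) n (r : R) : series R n :=
  fun m => if m == [ffun=> 0%N] then r else 0.
Definition ps_one (R : comNzRingType) n : series R n := @ps_const R n 1.
Definition ps_add (R : comNzRingType) n (f g : series R n) : series R n :=
  fun m => f m + g m.
Definition ps_sub (R : comNzRingType) n (f g : series R n) : series R n :=
  fun m => f m - g m.
Definition ps_mul (R : comNzRingType) n (f g : series R n) : series R n :=
  fun m => \sum_(d : {ffun 'I_n -> 'I_(\max_(i < n) m i).+1} | [forall i, (d i <= m i)%N])
             f [ffun i => (d i : nat)] * g [ffun i => (m i - d i)%N].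

(* Artinian power series: all coefficients lie in one finitely generated
   R0-subalgebra R0[s] of R, i.e. in one member of F(R0,R). *)
Definition artinian_series (R : comNzRingType) (R0 : R -> Prop) n (f : series R n) : Prop :=
  exists s : seq R, forall m, in_subalg R0 s (f m).

Definition art_ps_ring (R : comNzRingType) (R0 : R -> Prop) (n : nat) : cring :=
  @CRing (series R n) (@artinian_series R R0 n) (fun f g => forall m, f m = g m)
    (@ps_zero R n) (@ps_one R n) (@ps_add R n) (@ps_mul R n).

Definition ext_ideal (R : comNzRingType) (R0 : R -> Prop) n (M : R -> Prop) : series R n -> Prop :=
  gen_ideal (art_ps_ring R0 n) (fun f => exists r, M r /\ f = @ps_const R n r).

Definition quot_cring (R : comNzRingType) (R0 : R -> Prop) n (I : series R n -> Prop) : cring :=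
  @CRing (series R n) (@artinian_series R R0 n) (fun f g => I (ps_sub f g))
    (@ps_zero R n) (@ps_one R n) (@ps_add R n) (@ps_mul R n).

Definition integral_over (R : comNzRingType) (R0 : R -> Prop) : Prop :=
  forall x : R, exists p : {poly R},
    p \is monic /\ (forall i, R0 p`_i) /\ root p x.

(* Main.v *)
(** Modulo a prime [M] of [R] a series in [S] has a leading monomial for the
    graded lexicographic order, with invertible leading coefficient since [R/M]
    is a field.  By Dickson's lemma every ideal [I] containing [M] has a finite
    standard basis [h_a], and division (whose coefficients stay in the
    subalgebra generated by those of the data, so never leave [S]) writes every
    [f] in [I] of order at least [N + c] as a sum of [q_a h_a] modulo [MS] with
    [q_a] of order at least [N].  This gives Noetherianity and, for a prime [P]
    and [x] outside [P], an Artin-Rees bound: if [a x] is in [P] up to order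
    [N + c], then [a] is in [P] up to order [N].  If [P_0 < ... < P_(n+1)] were
    a chain of primes containing [M] and [x_i] in [P_(i+1)] outside [P_i], these
    bounds would make the [E^(n+1)] monomials in [x_0, ..., x_n] with exponents
    below [E] linearly independent over [R/M] modulo order [N], for some [N]
    linear in [E]; but series modulo order [N] form a space of dimension at most
    [N^n], a contradiction for [E] large.  The extended ideal [MS] consists of
    the series with coefficients in [M] because [R0] is Noetherian and each
    [R0[s]] is a finite [R0]-module. *)
From HB Require Import structures.
From mathcomp Require Import all_boot all_order all_algebra.
From mathcomp Require Import boolp ring.
From mathcomp Require Import mpoly.
Require Import Defs.
Set Implicit Arguments. Unset Strict Implicit. Unset Printing Implicit Defensive.
Import Order.TTheory GRing.Theory.
Local Open Scope ring_scope.

(** * Monomials *)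

Section Monomials.
Variable n : nat.
Implicit Types a b c m : mindex n.

Definition madd a b : mindex n := [ffun i => (a i + b i)%N].
Definition msub a b : mindex n := [ffun i => (a i - b i)%N].
Definition mone : mindex n := [ffun=> 0%N].
Definition mle a b := [forall i, (a i <= b i)%N].
Definition tdeg a : nat := (\sum_i a i)%N.

(** Built over the index type of the sum in [ps_mul], so that [ps_mulE] is a mere reindexing. *)
Definition below m : seq (mindex n) :=
  [seq [ffun i => (d i : nat)] |
    d : {ffun 'I_n -> 'I_(\max_(i < n) m i).+1} <-
      [seq d : {ffun 'I_n -> 'I_(\max_(i < n) m i).+1} <- enum predT |
        [forall i, (d i <= m i)%N]]].

Lemma mleP a b : reflect (forall i, (a i <= b i)%N) (mle a b).
Proof. exact: forallP. Qed.

Lemma mle_trans b a c : mle a b -> mle b c -> mle a c.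
Proof. by move=> /mleP h /mleP k; apply/mleP => i; apply: leq_trans (h i) (k i). Qed.

Lemma maddC a b : madd a b = madd b a.
Proof. by apply/ffunP => i; rewrite !ffunE addnC. Qed.

Lemma mle1 a : mle mone a.
Proof. by apply/mleP => i; rewrite ffunE. Qed.

Lemma mle_add a b : mle b (madd a b).
Proof. by apply/mleP => i; rewrite ffunE leq_addl. Qed.

Lemma mle_sub a b : mle (msub a b) a.
Proof. by apply/mleP => i; rewrite ffunE leq_subr. Qed.

Lemma maddK a b : msub (madd a b) b = a.
Proof. by apply/ffunP => i; rewrite !ffunE addnK. Qed.

Lemma msubK a b : mle b a -> madd (msub a b) b = a.
Proof. by move/mleP=> h; apply/ffunP => i; rewrite !ffunE subnK. Qed.

Lemma msub1 a : msub a mone = a.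
Proof. by apply/ffunP => i; rewrite !ffunE subn0. Qed.

Lemma msubKC a b : mle b a -> msub a (msub a b) = b.
Proof. by move/mleP=> h; apply/ffunP => i; rewrite !ffunE subKn. Qed.

Lemma msubA a b c : msub a (madd b c) = msub (msub a b) c.
Proof. by apply/ffunP => i; rewrite !ffunE subnDA. Qed.

Lemma maddI a : injective (madd^~ a).
Proof. by move=> b c /(congr1 (msub^~ a)); rewrite !maddK. Qed.

Lemma mle_addl a b c : mle (madd b c) a = mle c a && mle b (msub a c).
Proof.
apply/mleP/andP => [h|[/mleP h /mleP k] i]; last first.
  by have := k i; rewrite !ffunE leq_subRL ?h // addnC.
split; apply/mleP => i; have := h i; rewrite !ffunE.
  by apply: leq_trans; rewrite leq_addl.
by move=> hi; rewrite leq_subRL 1?addnC // (leq_trans _ hi) // leq_addl.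
Qed.

Lemma mem_below m c : (c \in below m) = mle c m.
Proof.
apply/mapP/idP => [[d]|/mleP h].
  by rewrite mem_filter => /andP[/forallP h _] ->; apply/mleP => i; rewrite ffunE.
have hb i : (c i < (\max_(i < n) m i).+1)%N.
  by rewrite ltnS (leq_trans (h i)) // (@leq_bigmax _ m).
exists [ffun i => Ordinal (hb i)]; last by apply/ffunP => i; rewrite !ffunE.
rewrite mem_filter mem_enum; apply/andP; split=> //.
by apply/forallP => i; rewrite ffunE; apply: h.
Qed.

Lemma below_uniq m : uniq (below m).
Proof.
rewrite map_inj_uniq ?(filter_uniq _ (enum_uniq _)) // => d e /ffunP h.
by apply/ffunP => i; apply: val_inj; have := h i; rewrite !ffunE.
Qed.

Lemma perm_below_sub m : perm_eq [seq msub m c | c <- below m] (below m).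
Proof.
apply: uniq_perm (below_uniq m) _.
  rewrite map_inj_in_uniq ?below_uniq // => a b.
  by rewrite !mem_below => ha hb /(congr1 (msub m)); rewrite !msubKC.
move=> c; rewrite mem_below; apply/mapP/idP => [[d _ ->]|h]; first exact: mle_sub.
by exists (msub m c); rewrite ?mem_below ?mle_sub ?msubKC.
Qed.

Lemma perm_below_filter m c :
  mle c m -> perm_eq (below c) [seq d <- below m | mle d c].
Proof.
move=> h; apply: uniq_perm (below_uniq c) (filter_uniq _ (below_uniq m)) _ => d.
rewrite mem_filter !mem_below; case hd: (mle d c) => //=.
by rewrite (mle_trans hd h).
Qed.

Lemma perm_below_shift m d : mle d m ->
  perm_eq [seq madd e d | e <- below (msub m d)] [seq c <- below m | mle d c].
Proof.
move=> h; apply: uniq_perm _ (filter_uniq _ (below_uniq m)) _.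
  by rewrite map_inj_uniq ?below_uniq //; apply: maddI.
move=> c; rewrite mem_filter mem_below; apply/mapP/andP => [[e]|[hd hc]].
  by rewrite mem_below => he ->; rewrite mle_add mle_addl h he.
exists (msub c d); last by rewrite msubK.
by rewrite mem_below; move: hc; rewrite -{1}(msubK hd) mle_addl => /andP[].
Qed.

Lemma tdegD a b : tdeg (madd a b) = (tdeg a + tdeg b)%N.
Proof. by rewrite /tdeg -big_split; apply: eq_bigr => i _; rewrite ffunE. Qed.

Lemma mle_deg a i : (a i <= tdeg a)%N.
Proof. by rewrite /tdeg (bigD1 i) //= leq_addr. Qed.

Lemma tdeg_eq0 a : tdeg a = 0%N -> a = mone.
Proof.
move=> h; apply/ffunP => i; rewrite ffunE.
by apply/eqP; rewrite -leqn0 -h mle_deg.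
Qed.

Lemma tdeg1 : tdeg mone = 0%N.
Proof. by rewrite /tdeg big1 // => i _; rewrite ffunE. Qed.

(** Transports the graded lexicographic order of multinomials, which is well founded, additive and
    compatible with total degree. *)
Definition to_mnm a : multinom n := Multinom [tuple a i | i < n].

Definition mlt a b := (to_mnm a < to_mnm b)%O.

Lemma to_mnmE a i : to_mnm a i = a i.
Proof. exact: mpoly.mnmE. Qed.

Lemma to_mnm_inj : injective to_mnm.
Proof.
move=> a b h; apply/ffunP => i.
by have := congr1 (fun u : multinom n => u i) h; rewrite /= !to_mnmE.
Qed.

Lemma mlt_irr a : mlt a a = false.
Proof. exact: ltxx. Qed.

Lemma mlt_total a b : [\/ mlt a b, a = b | mlt b a].
Proof.
have := ltgtP (to_mnm a) (to_mnm b); rewrite /mlt.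
by case => [||/to_mnm_inj]; [constructor 1|constructor 3|constructor 2].
Qed.

Lemma to_mnmD a b : to_mnm (madd a b) = mnm_add (to_mnm a) (to_mnm b).
Proof. by apply/mpoly.mnmP => i; rewrite mnmDE !to_mnmE ffunE. Qed.

Lemma mlt_add2r c a b : mlt (madd a c) (madd b c) = mlt a b.
Proof. by rewrite /mlt !to_mnmD ltmc_add2l. Qed.

Lemma mlt_deg a b : mlt a b -> (tdeg a <= tdeg b)%N.
Proof.
have hd c : mpoly.mdeg (to_mnm c) = tdeg c.
  by rewrite mdegE; apply: eq_bigr => i _; rewrite to_mnmE.
by move=> /ltW /lemc_mdeg; rewrite !hd.
Qed.

Lemma mlt_wf : well_founded (fun a b => mlt a b).
Proof.
move=> a; move em: (to_mnm a) => m; elim/(@ltmwf n): m a em => m ih a em.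
by constructor => b; rewrite /mlt em => /ih; apply.
Qed.

Lemma mlt_ind (P : mindex n -> Prop) :
  (forall m, (forall b, mlt b m -> P b) -> P m) -> forall m, P m.
Proof. by move=> h m; elim: (mlt_wf m) => {}m _; apply: h. Qed.

Lemma exists_mlt_min (P : mindex n -> Prop) m : P m ->
  exists2 a, P a & forall b, mlt b a -> ~ P b.
Proof.
elim/mlt_ind: m => m ih hm; case: (pselect (exists2 b, mlt b m & P b)).
  by case=> b /ih h /h.
by move=> h; exists m => // b hb pb; apply: h; exists b.
Qed.

(** A monomial preceding [m] has degree, hence every exponent, at most [tdeg m]; searching this box
    therefore misses none, and only finitely many monomials precede [m]. *)
Definition lows m := [seq b <- below [ffun=> tdeg m] | mlt b m].

Lemma mem_lows m b : (b \in lows m) = mlt b m.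
Proof.
rewrite mem_filter mem_below; case hb: (mlt b m) => //=.
by apply/mleP => i; rewrite ffunE (leq_trans (mle_deg b i)) // mlt_deg.
Qed.

Lemma lows_uniq m : uniq (lows m).
Proof. by rewrite filter_uniq // below_uniq. Qed.

(** Induction on the number [k] of exponents compared by [lek]. If [N] bounds the next exponent on a
    list [L] found for [k], then [L] serves all [b] whose next exponent is at least [N], and each of
    the finitely many slices with next exponent [v < N] gets its own list [F v]. *)
Lemma dickson (P : mindex n -> Prop) : exists L : seq (mindex n),
  (forall a, a \in L -> P a) /\
  forall b, P b -> exists2 a, a \in L & mle a b.
Proof.
pose lek k a b := forall i : 'I_n, (i < k)%N -> (a i <= b i)%N.
suff H k : (k <= n)%N -> forall P : mindex n -> Prop, exists L : seq (mindex n),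
    (forall a, a \in L -> P a) /\ forall b, P b -> exists2 a, a \in L & lek k a b.
  have [L [h1 h2]] := H n (leqnn n) P; exists L; split=> // b /h2[a aL h].
  by exists a => //; apply/mleP => i; apply: h.
elim: k => [|k ih] hk {}P.
  case: (pselect (exists a, P a)) => [[a pa]|h]; last first.
    by exists [::]; split=> // b pb; case: h; exists b.
  by exists [:: a]; split=> [b|b _]; [rewrite inE => /eqP -> | exists a; rewrite ?inE].
have [L [h1 h2]] := ih (ltnW hk) P.
pose ok := Ordinal hk.
pose N := (\max_(a <- L) a ok)%N.
have hN a : a \in L -> (a ok <= N)%N by move=> aL; rewrite /N (big_rem a) //= leq_maxl.
have [F hF] := choice (fun v => ih (ltnW hk) (fun a => P a /\ a ok = v)).
exists (L ++ flatten [seq F v | v <- iota 0 N]); split.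
  move=> a; rewrite mem_cat => /orP[/h1 //|/flatten_mapP[v _]].
  by case: (hF v) => h _ /h[].
have lekS a b : lek k a b -> (a ok <= b ok)%N -> lek k.+1 a b.
  move=> h h' i; rewrite ltnS leq_eqVlt => /orP[/eqP e|/h //].
  by rewrite (_ : i = ok) //; apply: val_inj.
move=> b pb; case: (ltnP (b ok) N) => hb.
  have [a aF ha] := (hF (b ok)).2 b (conj pb erefl).
  have [_ e] := (hF (b ok)).1 a aF.
  exists a; last by apply: lekS ha _; rewrite e.
  rewrite mem_cat; apply/orP; right; apply/flatten_mapP; exists (b ok) => //.
  by rewrite mem_iota.
have [a aL ha] := h2 b pb; exists a; first by rewrite mem_cat aL.
exact: lekS ha (leq_trans (hN a aL) hb).
Qed.

End Monomials.

(** * Power series *)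

(** A name of its own, on which the convolution product is declared as the ring structure of all
    power series over [R]. *)
Definition pser (R : comNzRingType) n : Type := series R n.

Section PowerSeriesRing.
Variables (R : comNzRingType) (n : nat).
Implicit Types (f g h : series R n) (m : mindex n).

Lemma ps_mulE f g m :
  ps_mul f g m = \sum_(c <- below m) f c * g (msub m c).
Proof.
rewrite /ps_mul /below big_map big_filter [RHS]big_enum_cond.
apply: eq_bigr => d _; congr (_ * g _).
by apply/ffunP => i; rewrite !ffunE.
Qed.

Let opp f : series R n := fun m => - f m.

Let addA : associative (@ps_add R n).
Proof. by move=> f g h; apply: funext => m; apply: addrA. Qed.

Let addC : commutative (@ps_add R n).
Proof. by move=> f g; apply: funext => m; apply: addrC. Qed.

Let add0 : left_id (@ps_zero R n) (@ps_add R n).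
Proof. by move=> f; apply: funext => m; apply: add0r. Qed.

Let addN : left_inverse (@ps_zero R n) opp (@ps_add R n).
Proof. by move=> f; apply: funext => m; apply: addNr. Qed.

Let mulC : commutative (@ps_mul R n).
Proof.
move=> f g; apply: funext => m; rewrite !ps_mulE.
rewrite -(perm_big _ (perm_below_sub m)) big_map.
apply: eq_big_seq => c; rewrite mem_below => hc.
by rewrite msubKC // mulrC.
Qed.

Let mulA : associative (@ps_mul R n).
Proof.
move=> f g h; apply: funext => m; rewrite !ps_mulE.
(* Both sides become a sum over chains [d] dividing [c] dividing [m], with factors at [d], [c - d]
   and [m - c]. *)
transitivity (\sum_(d <- below m) \sum_(c <- below m | mle d c)
    f d * g (msub c d) * h (msub m c)).
  apply: eq_big_seq => d; rewrite mem_below => hd.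
  rewrite ps_mulE mulr_sumr -[in RHS]big_filter -(perm_big _ (perm_below_shift hd)).
  by rewrite [RHS]big_map; apply: eq_bigr => e _; rewrite maddK mulrA maddC msubA.
rewrite (exchange_big_dep predT) //=; apply: eq_big_seq => c.
rewrite mem_below => hc; rewrite ps_mulE mulr_suml.
by rewrite (perm_big _ (perm_below_filter hc)) big_filter.
Qed.

Let mul1 : left_id (@ps_one R n) (@ps_mul R n).
Proof.
move=> f; apply: funext => m; rewrite ps_mulE.
rewrite (bigD1_seq (mone n)) ?mem_below ?mle1 ?below_uniq //=.
rewrite msub1 big1 ?addr0; first by rewrite /ps_one /ps_const eqxx mul1r.
by move=> c /negbTE hc; rewrite /ps_one /ps_const hc mul0r.
Qed.

Let mulD : left_distributive (@ps_mul R n) (@ps_add R n).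
Proof.
move=> f g h; apply: funext => m; rewrite /ps_add !ps_mulE -big_split.
by apply: eq_bigr => c _; rewrite mulrDl.
Qed.

Let one_neq0 : @ps_one R n <> @ps_zero R n.
Proof.
move=> /(congr1 (fun f => f (mone n))) /eqP.
by rewrite /ps_one /ps_const /ps_zero eqxx oner_eq0.
Qed.

HB.instance Definition _ := gen_eqMixin (pser R n).
HB.instance Definition _ := gen_choiceMixin (pser R n).
HB.instance Definition _ :=
  GRing.isZmodule.Build (pser R n) addA addC add0 addN.

Let one_neq0' : (@ps_one R n : pser R n) != (@ps_zero R n : pser R n).
Proof. exact/eqP/one_neq0. Qed.

HB.instance Definition _ :=
  GRing.Zmodule_isComNzRing.Build (pser R n) mulA mulC mul1 mulD one_neq0'.

End PowerSeriesRing.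

Section Coefficients.
Variables (R : comNzRingType) (n : nat).
Implicit Types (f g : pser R n) (m a b : mindex n).

Definition psC (r : R) : pser R n := @ps_const R n r.

Definition psX a : pser R n := fun m => if m == a then 1 else 0.

Lemma ps_coefD f g m : (f + g) m = f m + g m.
Proof. by []. Qed.

Lemma ps_coefB f g m : (f - g) m = f m - g m.
Proof. by []. Qed.

Lemma ps_coefM f g m : (f * g) m = \sum_(c <- below m) f c * g (msub m c).
Proof. exact: ps_mulE. Qed.

Lemma ps_coef_sum (I : Type) (r : seq I) (P : pred I) (F : I -> pser R n) m :
  (\sum_(i <- r | P i) F i) m = \sum_(i <- r | P i) F i m.
Proof. exact: (big_morph (fun f : pser R n => f m)). Qed.

Lemma ps_coefC r m : psC r m = if m == mone n then r else 0.
Proof. by []. Qed.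

Lemma psCM r s : psC (r * s) = psC r * psC s.
Proof.
apply: funext => m; rewrite ps_coefM.
rewrite (bigD1_seq (mone n)) ?mem_below ?mle1 ?below_uniq //=.
rewrite msub1 big1 ?addr0; first by rewrite !ps_coefC eqxx; case: eqP; rewrite ?mulr0.
by move=> c /negbTE hc; rewrite ps_coefC hc mul0r.
Qed.

Lemma psCD r s : psC (r + s) = psC r + psC s.
Proof. by apply: funext => m; rewrite ps_coefD !ps_coefC; case: eqP; rewrite ?addr0. Qed.

Lemma ps_coefCM r f m : (psC r * f) m = r * f m.
Proof.
rewrite ps_coefM (bigD1_seq (mone n)) ?mem_below ?mle1 ?below_uniq //=.
rewrite msub1 big1 ?addr0 ?ps_coefC ?eqxx //.
by move=> c /negbTE hc; rewrite ps_coefC hc mul0r.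
Qed.

End Coefficients.

(** * Division of power series *)

(** Forward substitution along the well-founded monomial order. *)
Lemma triangular_system (R : comNzRingType) n (f : mindex n -> R)
    (u : mindex n -> mindex n -> R) :
  exists t : mindex n -> R,
    forall m, t m = f m - \sum_(b <- lows m) t b * u b m.
Proof.
pose F m (rec : forall b, mlt b m -> R) :=
  f m - \sum_(b <- lows m)
    (if pselect (mlt b m) is left hb then rec b hb else 0) * u b m.
exists (Fix (@mlt_wf n) (fun=> R) F) => m.
rewrite Fix_eq => [|k v w e].
  congr (_ - _); apply: eq_big_seq => b; rewrite mem_lows => hb.
  by case: pselect.
by congr (_ - _); apply: eq_bigr => b _; case: pselect => // hb; rewrite e.
Qed.

Section SubringClosure.
Variables (R : comNzRingType) (B : R -> Prop).
Hypothesis hB : subring_P B.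

Lemma subring1 : B 1.
Proof. by case: hB. Qed.

Lemma subringB x y : B x -> B y -> B (x - y).
Proof. by case: hB => _ h _; apply: h. Qed.

Lemma subringM x y : B x -> B y -> B (x * y).
Proof. by case: hB => _ _ h; apply: h. Qed.

Lemma subring0 : B 0.
Proof. by rewrite -(subrr 1); apply: subringB subring1 subring1. Qed.

Lemma subringN x : B x -> B (- x).
Proof. by rewrite -[- x]add0r; apply: subringB subring0. Qed.

Lemma subringD x y : B x -> B y -> B (x + y).
Proof. by move=> hx hy; rewrite -[y]opprK; apply: subringB => //; apply: subringN. Qed.

Lemma subring_sum (I : eqType) (r : seq I) (P : pred I) (F : I -> R) :
  (forall i, i \in r -> P i -> B (F i)) -> B (\sum_(i <- r | P i) F i).
Proof.
move=> h; rewrite big_seq_cond; elim/big_ind: _ => //; first exact: subring0.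
  exact: subringD.
by move=> i /andP[]; apply: h.
Qed.

End SubringClosure.

Section Division.
Variables (R : comNzRingType) (n : nat) (B : R -> Prop).
Variables (L : seq (mindex n)) (h : mindex n -> pser R n).
Hypothesis hB : subring_P B.
Hypothesis L_uniq : uniq L.
Hypothesis h_lead : forall a, a \in L -> h a a = 1.
Hypothesis h_low : forall a b, a \in L -> mlt b a -> h a b = 0.
Hypothesis h_coef : forall a b, a \in L -> B (h a b).

Let divisor b := ohead [seq a <- L | mle a b].

Let divisorP b a : divisor b = Some a -> a \in L /\ mle a b.
Proof.
rewrite /divisor; case e: [seq _ <- _ | _] => [//|a' s] [<-].
have : a' \in [seq a <- L | mle a b] by rewrite e mem_head.
by rewrite mem_filter => /andP[].
Qed.

Let divisorN b a : divisor b = None -> a \in L -> mle a b = false.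
Proof.
rewrite /divisor; case e: [seq _ <- _ | _] => [|//] _ aL.
have : a \in [seq a <- L | mle a b] = false by rewrite e.
by rewrite mem_filter aL andbT.
Qed.

(* The product of [h a] with the monomial [b - a], where [a] is the chosen
   divisor of [b]; its leading monomial is [b]. *)
Let u b m := if divisor b is Some a then
  (if mle (msub b a) m then h a (msub m (msub b a)) else 0) else 0.

(** At each monomial [b] with a chosen divisor [a], a multiple of [h a] times the monomial [b - a]
    cancels what is left of [f]. The system for the multipliers [t] is unitriangular, so solving it
    uses ring operations of [B] only; the order is graded, so [t] vanishes in every degree below the
    order of [f]. *)
Lemma power_series_division (f : pser R n) : (forall m, B (f m)) ->
  exists (q : mindex n -> pser R n) (r : pser R n),
  [/\ f = \sum_(a <- L) q a * h a + r,
      (forall a m, B (q a m)) /\ (forall m, B (r m)),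
      (forall m a, a \in L -> mle a m -> r m = 0)
    & forall N, (forall m, (tdeg m < N)%N -> f m = 0) ->
      forall a c, (tdeg c + tdeg a < N)%N -> q a c = 0].
Proof.
move=> hf; have [t ht] := triangular_system f u.
have tB m : B (t m).
  elim/mlt_ind: m => m ih; rewrite ht; apply: subringB (hf m) _ => //.
  apply: subring_sum => // b; rewrite mem_lows => hb _.
  apply: subringM => //; first exact: ih.
  rewrite /u; case e: (divisor b) => [a|]; last exact: subring0.
  by case: ifP => _; [apply: h_coef; case: (divisorP e) | apply: subring0].
(* The multiplier at [b = c + a] goes to the quotient of the divisor chosen for [b]; where there is
   none, it goes to the remainder. *)
pose q a : pser R n :=
  fun c => if divisor (madd c a) == Some a then t (madd c a) else 0.
pose r : pser R n := fun m => if divisor m is None then t m else 0.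
exists q, r; split.
- apply: funext => m; rewrite ps_coefD ps_coef_sum.
  pose D := m :: lows m.
  have uD : uniq D by rewrite /= mem_lows mlt_irr lows_uniq.
  transitivity (\sum_(b <- D) t b * u b m + r m).
    rewrite big_cons [t m]ht /r /u; case e: (divisor m) => [a|].
      have [aL ha] := divisorP e.
      by rewrite mle_sub msubKC // h_lead // addr0 mulr1 subrK.
    by rewrite mulr0 add0r [t m]ht addrC subrK.
  (* The monomials up to [m] are grouped by their chosen divisor [a], then matched with the terms of
     [q a * h a] through [b = c + a]. *)
  congr (_ + _); transitivity
      (\sum_(a <- L) \sum_(b <- D | divisor b == Some a) t b * u b m).
    rewrite (exchange_big_dep predT) //=; apply: eq_bigr => b _.
    rewrite /u; case e: (divisor b) => [a|]; last first.
      by rewrite mulr0 big1.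
    have [aL ha] := divisorP e.
    rewrite -big_filter (_ : [seq _ <- _ | _] = [:: a]) ?big_seq1 //.
    rewrite -(filter_pred1_uniq L_uniq aL); apply: eq_filter => c /=.
    by rewrite eq_sym; apply/eqP/eqP => [[]|->].
  apply: eq_big_seq => a aL; rewrite ps_coefM.
  pose C := [seq c <- below m | (divisor (madd c a) == Some a) && (madd c a \in D)].
  pose E := [seq b <- D | (divisor b == Some a) && mle (msub b a) m].
  have CE : perm_eq [seq madd c a | c <- C] E.
    apply: uniq_perm (filter_uniq _ uD) _.
      by rewrite map_inj_uniq ?filter_uniq ?below_uniq //; apply: maddI.
    move=> b; rewrite mem_filter; apply/mapP/andP.
      case=> c; rewrite mem_filter mem_below => /andP[/andP[h1 h2] h3] ->.
      by rewrite h1 h2 maddK h3.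
    case=> /andP[/eqP h1 h2] h3; have [_ h4] := divisorP h1.
    exists (msub b a); last by rewrite msubK.
    by rewrite mem_filter mem_below msubK // h1 eqxx h3 h2.
  transitivity (\sum_(b <- E) t b * h a (msub m (msub b a))).
    rewrite /E big_filter big_mkcondr; apply: eq_bigr => b /eqP e.
    by rewrite /u e; case: ifP => _; rewrite ?mulr0.
  rewrite -(perm_big _ CE) big_map /C big_filter big_mkcond /=.
  apply: eq_big_seq => c; rewrite mem_below maddK => hc.
  rewrite /q; case: eqP => /= _; last by rewrite mul0r.
  (* If [c + a] is not in [D] it exceeds [m], so [m - c] precedes [a], where [h a] vanishes. *)
  case: ifP => // hD; rewrite h_low ?mulr0 // -(mlt_add2r c) msubK // maddC.
  have := mlt_total m (madd c a); case=> [//|e|hl].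
    by move: hD; rewrite -e mem_head.
  by move: hD; rewrite inE mem_lows hl orbT.
- split=> [a m|m]; rewrite ?/q ?/r; first by case: ifP => _ //; apply: subring0.
  by case: (divisor m) => [_|//]; apply: subring0.
- move=> m a aL ha; rewrite /r; case e: (divisor m) => //.
  by rewrite (divisorN e) in ha.
- move=> N hN.
  have t0 m : (tdeg m < N)%N -> t m = 0.
    elim/mlt_ind: m => m ih hm; rewrite ht hN // big_seq big1 ?subr0 // => b.
    rewrite mem_lows => hb; rewrite ih ?mul0r //.
    exact: leq_ltn_trans (mlt_deg hb) hm.
  by move=> a c hc; rewrite /q; case: ifP => // _; rewrite t0 ?tdegD.
Qed.

End Division.

(** * Integral extensions of Artinian rings *)

Section Submodules.
Variables (R : comNzRingType) (B : R -> Prop).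
Hypothesis hB : subring_P B.

Definition submodule (V : R -> Prop) : Prop :=
  [/\ V 0, (forall x y, V x -> V y -> V (x + y))
    & (forall a x, B a -> V x -> V (a * x))].

(** Stated as an intersection of submodules, so that a membership hypothesis serves as its own
    induction principle. *)
Definition lspan (l : seq R) (x : R) : Prop :=
  forall V, submodule V -> (forall y, y \in l -> V y) -> V x.

Definition fin_gen (V : R -> Prop) : Prop :=
  exists l : seq R, (forall x, x \in l -> V x) /\ forall x, V x -> lspan l x.

Lemma submoduleB V x y : submodule V -> V x -> V y -> V (x - y).
Proof.
move=> [_ hD hM] hx hy; apply: hD => //; rewrite -mulN1r; apply: hM => //.
by apply: subringN => //; apply: subring1.
Qed.

Lemma lspan_submodule l : submodule (lspan l).
Proof.
split=> [V [] //|x y hx hy V hV hl|a x ha hx V hV hl].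
  by have [_ hD _] := hV; apply: hD; [apply: hx | apply: hy].
by have [_ _ hM] := hV; apply: hM => //; apply: hx.
Qed.

Lemma mem_lspan l x : x \in l -> lspan l x.
Proof. by move=> hx V _; apply. Qed.

Lemma lspan_sub l l' x : (forall y, y \in l -> lspan l' y) -> lspan l x -> lspan l' x.
Proof. by move=> h; apply => //; apply: lspan_submodule. Qed.

Lemma lspan_nil x : lspan [::] x -> x = 0.
Proof.
by move/(_ (fun z => z = 0)); apply; first split=> [|u v -> ->|a u _ ->];
  rewrite ?addr0 ?mulr0.
Qed.

Lemma lspan_cons l y x : lspan (y :: l) x -> exists2 b, B b & lspan l (x - b * y).
Proof.
have [h0 hD hM] := lspan_submodule l.
move=> hx; apply: (hx (fun z => exists2 b, B b & lspan l (z - b * y))); first split.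
- by exists 0; [apply: subring0 | rewrite mul0r subr0].
- move=> u v [b hb hu] [c hc hv]; exists (b + c); first exact: subringD.
  by rewrite (_ : _ - _ = (u - b * y) + (v - c * y)); [apply: hD | ring].
- move=> a u ha [b hb hu]; exists (a * b); first exact: subringM.
  by rewrite (_ : _ - _ = a * (u - b * y)); [apply: hM | ring].
move=> z; rewrite inE => /orP[/eqP ->|hz].
  by exists 1; [apply: subring1 | rewrite mul1r subrr].
by exists 0; [apply: subring0 | rewrite mul0r subr0; apply: mem_lspan].
Qed.

(** Generators of [K] together with lifts of generators of [V/K] generate [V]. *)
Lemma fin_gen_extension V K l : submodule V -> fin_gen K ->
  (forall x, K x -> V x) -> (forall x, x \in l -> V x) ->
  (forall x, V x -> exists2 y, lspan l y & K (x - y)) -> fin_gen V.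
Proof.
move=> hV [k [hk1 hk2]] hKV hl h; exists (l ++ k); split=> x.
  by rewrite mem_cat => /orP[/hl|/hk1/hKV].
case/h=> y hy hxy; rewrite -(subrK y x); have [_ hD _] := lspan_submodule (l ++ k).
by apply: hD; [move: (hk2 _ hxy) | move: hy]; apply: lspan_sub => z hz;
  apply: mem_lspan; rewrite mem_cat hz ?orbT.
Qed.

(** Multiplication by [a] presents [V] as an extension of its image by its kernel. *)
Lemma fin_gen_mul a V : submodule V -> B a ->
  fin_gen (fun x => exists2 v, V v & x = a * v) ->
  fin_gen (fun x => V x /\ a * x = 0) -> fin_gen V.
Proof.
move=> hV ha [l [hl1 hl2]] hK; have [V0 hD hM] := hV.
have /choice[g hg] z : exists v, z \in l -> V v /\ z = a * v.
  case: (boolP (z \in l)) => hz; last by exists 0.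
  by have [v hv e] := hl1 z hz; exists v.
apply: (fin_gen_extension (l := map g l) hV hK).
- by move=> x [].
- by move=> x /mapP[z /hg[h _] ->].
have lV x : lspan (map g l) x -> V x.
  by apply=> // y /mapP[z /hg[h _] ->].
move=> x hx; have [h0 hD' hM'] := lspan_submodule (map g l).
have [y hy e] : exists2 y, lspan (map g l) y & a * x = a * y.
  apply: (hl2 (a * x) _ (fun z => exists2 y, lspan (map g l) y & z = a * y)).
  - by exists x.
  - split=> [|u v [y hy ->] [y' hy' ->]|b u hb [y hy ->]].
    + by exists 0; rewrite ?mulr0.
    + by exists (y + y'); rewrite ?mulrDr //; apply: hD'.
    + by exists (b * y); [apply: hM' | ring].
  move=> z hz; have [_ e] := hg z hz; exists (g z) => //.
  by apply: mem_lspan; apply: map_f.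
exists y => //; split; first exact: submoduleB (lV _ hy).
by rewrite mulrBr e subrr.
Qed.

(** Submodules of a finite module over a Noetherian ring are finite, by induction on the generators
    of the ambient module. *)
Lemma fin_gen_sub_lspan l V :
  (forall I, submodule I -> (forall x, I x -> B x) -> fin_gen I) ->
  submodule V -> (forall x, V x -> lspan l x) -> fin_gen V.
Proof.
move=> hI; elim: l V => [|e l ih] V hV hVl.
  by exists [::].
have [V0 hD hM] := hV; have [N0 ND NM] := lspan_submodule l.
(* The ideal of coefficients at [e] of elements of [V]; lifting its generators generates [V] modulo
   the part lying in the span of [l]. *)
pose J a := B a /\ exists2 v, V v & lspan l (v - a * e).
have hJ : submodule J.
  split=> [|a b [ha [v hv hve]] [hb [w hw hwe]]|b a hb [ha [v hv hve]]].
  - by split; [apply: subring0 | exists 0 => //; rewrite mul0r subr0].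
  - split; first exact: subringD.
    exists (v + w); first exact: hD.
    by rewrite (_ : _ - _ = (v - a * e) + (w - b * e)); [apply: ND | ring].
  - split; first exact: subringM.
    exists (b * v); first exact: hM.
    by rewrite (_ : _ - _ = b * (v - a * e)); [apply: NM | ring].
have [la [hla1 hla2]] := hI J hJ (fun x => @proj1 _ _).
have /choice[g hg] a : exists v, a \in la -> V v /\ lspan l (v - a * e).
  case: (boolP (a \in la)) => ha; last by exists 0.
  by have [_ [v hv hve]] := hla1 a ha; exists v.
have hK : fin_gen (fun x => V x /\ lspan l x).
  apply: ih => [|x [] //]; split=> // [x y [h1 h2] [h3 h4]|a x ha [h1 h2]].
    by split; [apply: hD | apply: ND].
  by split; [apply: hM | apply: NM].
apply: (fin_gen_extension (l := map g la) hV hK).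
- by move=> x [].
- by move=> x /mapP[z /hg[h _] ->].
have lV x : lspan (map g la) x -> V x.
  by apply=> // y /mapP[z /hg[h _] ->].
move=> x hx; have [h0 hD' hM'] := lspan_submodule (map g la).
have [a ha hxa] := lspan_cons (hVl x hx).
have [y hy hya] : exists2 y, lspan (map g la) y & lspan l (y - a * e).
  apply: (hla2 a _ (fun a => exists2 y, lspan (map g la) y & lspan l (y - a * e))).
  - by split=> //; exists x.
  - split=> [|b c [y hy hy'] [z hz hz']|b c hb [y hy hy']].
    + by exists 0 => //; rewrite mul0r subr0.
    + exists (y + z); first exact: hD'.
      by rewrite (_ : _ - _ = (y - b * e) + (z - c * e)); [apply: ND | ring].
    + exists (b * y); first exact: hM'.
      by rewrite (_ : _ - _ = b * (y - c * e)); [apply: NM | ring].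
  move=> b hb; have [_ h] := hg b hb; exists (g b) => //.
  by apply: mem_lspan; apply: map_f.
exists y => //; split; first exact: submoduleB (lV _ hy).
rewrite (_ : x - y = (x - a * e) - (y - a * e)); last by ring.
exact: submoduleB (lspan_submodule l) hxa hya.
Qed.

End Submodules.

Lemma seq_eventually (T : eqType) (l : seq T) (Q : nat -> T -> Prop) :
  (forall m k x, (m <= k)%N -> Q m x -> Q k x) ->
  (forall x, x \in l -> exists m, Q m x) ->
  exists m, forall x, x \in l -> Q m x.
Proof.
move=> hQ; elim: l => [|y l ih] h; first by exists 0%N.
have [m hm] := ih (fun x hx => h x (mem_behead (s := y :: l) hx)).
have [k hk] := h y (mem_head _ _); exists (maxn m k) => x.
rewrite inE => /orP[/eqP ->|/hm h']; last by apply: hQ h'; rewrite leq_maxl.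
by apply: hQ hk; rewrite leq_maxr.
Qed.

(** * Ideals of an Artinian ring are finitely generated *)

Section Artinian.
Variables (R : comNzRingType) (B : R -> Prop).
Hypothesis hB : subring_P B.
Hypothesis artB : artinian (@ring_cr R B).

Lemma submodule_ideal I :
  submodule B I -> (forall x, I x -> B x) -> is_ideal (@ring_cr R B) I.
Proof.
move=> [h0 hD hM] hI; split; [exact: hI | | exact: h0 | exact: hD | exact: hM].
by move=> x y _ /= ->.
Qed.

(** Without a minimal member, iterating a choice of a strictly smaller one from [I0] would give a
    descending chain that never stabilises. *)
Lemma artinian_minimal (P : (R -> Prop) -> Prop) I0 :
  (forall I, P I -> submodule B I /\ forall x, I x -> B x) -> P I0 ->
  exists2 I, P I &
    forall J, P J -> (forall x, J x -> I x) -> forall x, I x -> J x.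
Proof.
move=> hP h0; apply: contrapT => hmin.
have /choice[nx hnx] (I : R -> Prop) : exists J, P I ->
    [/\ P J, (forall x, J x -> I x) & ~ (forall x, I x -> J x)].
  case: (pselect (P I)) => hI; last by exists I.
  apply: contrapT => hJ; apply: hmin; exists I => // J hJ1 hJ2; apply: contrapT => hJ3.
  by apply: hJ; exists J.
pose C k := iter k nx I0.
have hC k : P (C k) by elim: k => //= k /hnx[].
case: (artB (I := C)).
- by move=> k; have [h1 h2] := hP _ (hC k); apply: submodule_ideal.
- by move=> k x; have [_ h _] := hnx _ (hC k); apply: h.
move=> N hN; have [_ h] := hN N.+1 (leqnSn N).
by have [_ _] := hnx _ (hC N); apply => x; apply: h.
Qed.

(** The descending chain of ideals generated by the powers of [a] stabilises. *)
Lemma artinian_power a : B a -> exists N, exists2 b, B b & a ^+ N = a ^+ N.+1 * b.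
Proof.
move=> ha; pose C k x := exists2 b, B b & x = a ^+ k * b.
case: (artB (I := C)).
- move=> k; apply: submodule_ideal; first split.
  + by exists 0; [apply: subring0 | rewrite mulr0].
  + move=> x y [b hb ->] [c hc ->]; exists (b + c); first exact: subringD.
    by rewrite mulrDr.
  + move=> x y hx [b hb ->]; exists (x * b); first exact: subringM.
    by rewrite mulrCA.
  + move=> x [b hb ->]; apply: subringM => //.
    by elim: k => [|k ih]; [apply: subring1 | rewrite exprS; apply: subringM].
- move=> k x [b hb ->]; exists (a * b); first exact: subringM.
  by rewrite exprSr mulrA.
move=> N hN; have [_ h] := hN N.+1 (leqnSn N).
have [b hb e] : C N.+1 (a ^+ N).
  by apply: h; exists 1; [apply: subring1 | rewrite mulr1].
by exists N; exists b.
Qed.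

(* An ideal minimal among those that are not finitely generated would be an
   infinite-dimensional vector space all of whose proper subspaces have finite
   dimension. *)
Lemma artinian_fin_gen I :
  submodule B I -> (forall x, I x -> B x) -> fin_gen B I.
Proof.
pose bad I := [/\ submodule B I, (forall x, I x -> B x) & ~ fin_gen B I].
move=> hI0 hIB0; apply: contrapT => hn0.
have [{hI0 hIB0 hn0}I [hI hIB hn] hmin] : exists2 I, bad I &
    forall J, bad J -> (forall x, J x -> I x) -> forall x, I x -> J x.
  by apply: artinian_minimal => [J [] //|]; split; [apply: hI0|..].
have [I0 ID IM] := hI.
(* The image and the kernel of [a] on [I] cannot both be finitely generated, and by minimality one
   that is not is all of [I]. *)
have hact a : B a -> (forall x, I x -> exists2 v, I v & x = a * v) \/
    (forall x, I x -> a * x = 0).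
  move=> ha; case: (pselect (fin_gen B (fun x => exists2 v, I v & x = a * v))) => h1.
    case: (pselect (fin_gen B (fun x => I x /\ a * x = 0))) => h2.
      by case: hn; apply: (fin_gen_mul hB hI ha).
    right=> x hx; suff [] : I x /\ a * x = 0 by [].
    apply: (hmin (fun x => I x /\ a * x = 0) _ _ x hx).
      split=> //; last by move=> y [/hIB].
      split=> [|y z [h3 h4] [h5 h6]|b y hb [h3 h4]]; first by rewrite mulr0.
        by rewrite mulrDr h4 h6 addr0; split=> //; apply: ID.
      by rewrite mulrCA h4 mulr0; split=> //; apply: IM.
    by move=> y [].
  left=> x hx; apply: (hmin (fun x => exists2 v, I v & x = a * v) _ _ x hx).
    split=> //; last by move=> y [v hv ->]; apply/hIB/IM.
    split; first by exists 0; rewrite ?mulr0.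
      move=> y z [v hv ->] [w hw ->]; exists (v + w); first exact: ID.
      by rewrite mulrDr.
    by move=> b y hb [v hv ->]; exists (b * v); [apply: IM | rewrite mulrCA].
  by move=> y [v hv ->]; apply: IM.
(* If [b] maps [I] onto itself, each [x] is [b ^+ N * v], so the [c] with [b ^+ N = b ^+ N.+1 * c]
   inverts [b] on [I]: scalars act as zero or invertibly, as over a field. *)
have hinv b : B b -> (forall x, I x -> b * x = 0) \/
    exists2 c, B c & forall x, I x -> c * (b * x) = x.
  move=> hb; case: (hact b hb) => [hs|]; [right | by left].
  have [N [c hc e]] := artinian_power hb; exists c => // x hx.
  have hsN k y : I y -> exists v, y = b ^+ k * v.
    elim: k y => [|k ih] y hy; first by exists y; rewrite mul1r.
    have [w hw ->] := hs y hy; have [v ->] := ih w hw.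
    by exists v; rewrite exprS mulrA.
  have [v ->] := hsN N x hx; rewrite {2}e exprS; ring.
have /choice[nx hnx] (l : seq R) : exists x,
    (forall y, y \in l -> I y) -> I x /\ ~ lspan B l x.
  apply: contrapT => h; apply: hn; exists l.
  have hl : forall y, y \in l -> I y.
    by apply: contrapT => hl; apply: h; exists 0.
  by split=> // x hx; apply: contrapT => hx'; apply: h; exists x.
(* [s k] lists [a (k-1), ..., a 0], each outside the span of its predecessors: a linearly
   independent sequence. *)
pose s := fix s k := if k is k'.+1 then nx (s k') :: s k' else [::].
have hs k y : y \in s k -> I y.
  elim: k y => //= k ih y; rewrite inE => /orP[/eqP ->|/ih //].
  by have [] := hnx (s k) ih.
pose a k := nx (s k).
have ha k : I (a k) /\ ~ lspan B (s k) (a k) by apply: hnx; apply: hs.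
(* The same sequence without [a 0]. The union [W] of the spans is again not finitely generated, so
   minimality forces [W] to be [I], and [a 0] would lie in [W]. *)
pose t := fix t k := if k is k'.+1 then a k'.+1 :: t k' else [::].
have hts k x : x \in t k -> x \in s k.+1.
  elim: k => //= k ih; rewrite inE => /orP[/eqP ->|/ih h]; first by rewrite mem_head.
  by rewrite inE h orbT.
have a0s k : a 0%N \in s k.+1.
  by elim: k => [|k ih]; rewrite [s _.+1]/= inE ?eqxx // ih orbT.
have tmono m k x : (m <= k)%N -> lspan B (t m) x -> lspan B (t k) x.
  move=> /subnK <-; elim: (k - m)%N => // j ih /ih; apply: lspan_sub => y hy.
  by apply: mem_lspan; rewrite /= inE hy orbT.
pose W x := exists m, lspan B (t m) x.
have hW : submodule B W.
  split=> [|x y [m hx] [k hy]|b x hb [m hx]].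
  - by exists 0%N; have [h _ _] := lspan_submodule B (t 0%N).
  - exists (maxn m k); have [_ h _] := lspan_submodule B (t (maxn m k)).
    apply: h; [apply: tmono hx | apply: tmono hy]; [exact: leq_maxl | exact: leq_maxr].
  - by exists m; have [_ _ h] := lspan_submodule B (t m); apply: h.
have WI x : W x -> I x.
  by move=> [m]; apply=> // y /hts; apply: hs.
have Wbad : bad W.
  split=> // [x /WI/hIB //|[l [hl1 hl2]]].
  have [m hm] := seq_eventually tmono hl1.
  have [_] := ha m.+1; apply.
  apply: (@lspan_sub _ _ (t m)); first by move=> y /hts; apply: mem_lspan.
  apply: (lspan_sub hm); apply: hl2; exists m.+1.
  by apply: mem_lspan; rewrite /= mem_head.
have [m] := hmin W Wbad WI _ (ha 0%N).1.
elim: m => [|m ih]; first exact: (ha 0%N).2.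
(* The last coefficient [b] in such an expression of [a 0] either kills its vector, which shortens
   the expression, or is invertible, which puts [a m.+1] in the span of its predecessors. *)
move=> /(lspan_cons hB)[b hb hab]; case: (hinv b hb) => [b0|[c hc hcb]].
  by move: hab; rewrite b0 ?subr0 //; exact: (ha _).1.
apply: (ha m.+1).2; rewrite -(hcb (a m.+1) (ha _).1).
rewrite (_ : _ * _ = c * (a 0%N - (a 0%N - b * a m.+1))); last by ring.
have [_ _ hM] := lspan_submodule B (s m.+1); apply: hM => //.
apply: submoduleB (lspan_submodule B _) _ _ => //; first exact: mem_lspan.
by apply: lspan_sub hab => y /hts; apply: mem_lspan.
Qed.

End Artinian.

(** * Finitely generated subalgebras are finite modules *)

Section Subalgebras.
Variables (R : comNzRingType) (R0 : R -> Prop).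

Lemma in_subalg_subring s : subring_P (in_subalg R0 s).
Proof.
split=> [P [] //|x y hx hy P hP h0 hs|x y hx hy P hP h0 hs].
  by apply: subringB => //; [apply: hx | apply: hy].
by apply: subringM => //; [apply: hx | apply: hy].
Qed.

Lemma in_subalg_base s x : R0 x -> in_subalg R0 s x.
Proof. by move=> hx P _ h _; apply: h. Qed.

Lemma in_subalg_gen s x : x \in s -> in_subalg R0 s x.
Proof. by move=> hx P _ _; apply. Qed.

Lemma in_subalg_mono s s' x :
  (forall y, y \in s -> in_subalg R0 s' y) -> in_subalg R0 s x -> in_subalg R0 s' x.
Proof.
move=> h hx; apply: hx (in_subalg_subring s') _ h.
exact: in_subalg_base.
Qed.

Hypothesis hR0 : subring_P R0.
Hypothesis hint : @integral_over R R0.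

(** The integral equation of [y] expresses its top power through lower ones, so the span of those
    lower powers is closed under products and is a subring containing [R0], [s] and [y]. *)
Lemma in_subalg_cons_lspan y s : exists d, forall x, in_subalg R0 (y :: s) x ->
  lspan (in_subalg R0 s) [seq y ^+ i | i <- iota 0 d] x.
Proof.
have [p [p_monic [p_coef p_root]]] := hint y.
set B := in_subalg R0 s; have hB : subring_P B := in_subalg_subring s.
exists (size p).-1 => x hx.
set l := [seq _ | _ <- _].
have [N0 ND NM] := lspan_submodule B l.
(* A monic constant has no root; positive degree puts [1] among the spanning powers. *)
have p_size : (0 < (size p).-1)%N.
  rewrite ltn_predRL ltnNge; apply/negP => /size1_polyC e.
  move: p_root p_monic; rewrite e rootC monicE lead_coefC => /eqP ->.
  by rewrite eq_sym oner_eq0.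
have hpow i : (i < (size p).-1)%N -> lspan B l (y ^+ i).
  by move=> hi; apply: mem_lspan; apply: map_f; rewrite mem_iota.
have h1 : lspan B l 1 by apply: (hpow 0%N).
have htop : lspan B l (y ^+ (size p).-1).
  have -> : y ^+ (size p).-1 = \sum_(i < (size p).-1) (- p`_i) * y ^+ i.
    apply/eqP; rewrite -subr_eq0 -sumrN.
    under eq_bigr => i _ do rewrite mulNr opprK.
    have /eqP e := p_root; apply/eqP; rewrite -[RHS]e horner_coef.
    have es : size p = (size p).-1.+1.
      by rewrite prednK // (leq_trans p_size) // leq_pred.
    have e1 : p`_(size p).-1 = 1 by have := monicP p_monic; rewrite lead_coefE.
    by rewrite [in RHS]es [RHS]big_ord_recr /= e1 mul1r addrC.
  elim/big_ind: _ => [|u v|i _]; [exact: N0 | exact: ND |].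
  apply: NM; last exact: hpow.
  by apply: (subringN hB); apply: in_subalg_base.
have hmuly z : lspan B l z -> lspan B l (z * y).
  move=> hz; apply: (hz (fun z => lspan B l (z * y))).
    split=> [|u v hu hv|a u ha hu]; first by rewrite mul0r.
      by rewrite mulrDl; apply: ND.
    by rewrite -mulrA; apply: NM.
  move=> w /mapP[i]; rewrite mem_iota add0n => /= hi ->; rewrite -exprSr.
  have : (i.+1 <= (size p).-1)%N by [].
  by rewrite leq_eqVlt => /orP[/eqP ->|/hpow].
have hmul z w : lspan B l z -> lspan B l w -> lspan B l (z * w).
  move=> hz hw; apply: (hw (fun w => lspan B l (z * w))).
    split=> [|u v hu hv|a u ha hu]; first by rewrite mulr0.
      by rewrite mulrDr; apply: ND.
    by rewrite mulrCA; apply: NM.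
  move=> v /mapP[i _ ->]; elim: i => [|i ih]; first by rewrite mulr1.
  by rewrite exprSr mulrA; apply: hmuly.
have hBl b : B b -> lspan B l b by move=> hb; rewrite -[b]mulr1; apply: NM.
apply: hx => [|z hz|z].
- split=> // u v hu hv; exact: submoduleB (lspan_submodule B l) hu hv.
- by apply: hBl; apply: in_subalg_base.
- rewrite inE => /orP[/eqP ->|hz]; last by apply: hBl; apply: in_subalg_gen.
  by have := hmuly 1 h1; rewrite mul1r.
Qed.

Lemma in_subalg_lspan s : exists l, forall x, in_subalg R0 s x -> lspan R0 l x.
Proof.
elim: s => [|y s [l hl]].
  exists [:: 1] => x; have [N0 ND NM] := lspan_submodule R0 [:: 1 : R].
  have hN b : R0 b -> lspan R0 [:: 1] b.
    by move=> hb; rewrite -[b]mulr1; apply: NM => //; apply: mem_lspan; rewrite inE.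
  by move/(_ _ hR0 (fun _ => id)) => h; apply: hN; apply: h.
have [d hd] := in_subalg_cons_lspan y s.
exists [seq v * y ^+ i | v <- l, i <- iota 0 d] => x /hd hx.
set l' := (X in lspan _ X _); have [N0 ND NM] := lspan_submodule R0 l'.
(* Allowing a factor [b] from [R0[s]] makes the property stable under [R0[s]], as induction on the
   span over [R0[s]] requires. *)
suff : forall b, in_subalg R0 s b -> lspan R0 l' (b * x).
  by move/(_ 1); rewrite mul1r; apply; apply: subring1 (in_subalg_subring s).
apply: (hx (fun x => forall b, in_subalg R0 s b -> lspan R0 l' (b * x))).
  split=> [b _|u v hu hv b hb|a u ha hu b hb]; first by rewrite mulr0.
    by rewrite mulrDr; apply: ND; [apply: hu | apply: hv].
  by rewrite mulrA; apply: hu; apply: subringM (in_subalg_subring s) _ _ _ _.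
move=> z /mapP[i hi ->] b /hl hb.
apply: (hb (fun b => lspan R0 l' (b * y ^+ i))).
  split=> [|u v hu hv|a u ha hu]; first by rewrite mul0r.
    by rewrite mulrDl; apply: ND.
  by rewrite -mulrA; apply: NM.
by move=> v hv; apply: mem_lspan; exact: (allpairs_f (fun v i => v * y ^+ i)).
Qed.

End Subalgebras.

(** * Primes of R and their residue fields *)

Section ResidueField.
Variables (R : comNzRingType) (R0 : R -> Prop).
Hypothesis hR0 : subring_P R0.
Hypothesis artR0 : artinian (@ring_cr R R0).
Hypothesis hint : @integral_over R R0.
Variable M : R -> Prop.
Hypothesis M_prime : is_prime (@ring_cr R (fun _ => True)) M.

Lemma prime_submodule : submodule (fun=> True) M.
Proof.
by have [[[_ _ h0 hD hM] _] _] := M_prime; split=> // a x _; apply: hM.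
Qed.

Lemma primeM a x : M x -> M (a * x).
Proof. by have [_ _ h] := prime_submodule; apply: h. Qed.

Lemma prime0 : M 0.
Proof. by have [h _ _] := prime_submodule. Qed.

Lemma primeD x y : M x -> M y -> M (x + y).
Proof. by have [_ h _] := prime_submodule; apply: h. Qed.

Lemma primeB x y : M x -> M y -> M (x - y).
Proof. by move=> hx hy; apply: primeD => //; rewrite -mulN1r; apply: primeM. Qed.

Lemma prime_sum (I : Type) (r : seq I) (P : pred I) (F : I -> R) :
  (forall i, P i -> M (F i)) -> M (\sum_(i <- r | P i) F i).
Proof. by move=> h; elim/big_ind: _ => //; [exact: prime0 | exact: primeD]. Qed.

Lemma prime_mul a b : M (a * b) -> M a \/ M b.
Proof. by have [_ h] := M_prime; apply: h. Qed.

Lemma prime1 : ~ M 1.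
Proof. by have [[_ h] _] := M_prime. Qed.

Lemma primeX a k : M (a ^+ k) -> M a.
Proof.
elim: k => [/prime1 //|k ih]; rewrite exprS => /prime_mul[//|]; exact: ih.
Qed.

(** The Artinian relation gives [a ^+ N * (b * a - 1) = 0], and the prime [M] contains no power of
    [a]. *)
Lemma base_invertible a : R0 a -> ~ M a -> exists2 v, R0 v & M (v * a - 1).
Proof.
move=> ha haM; have [N [b hb e]] := artinian_power hR0 artR0 ha.
exists b => //; have /prime_mul[/primeX //|//] : M (a ^+ N * (b * a - 1)).
rewrite (_ : _ * _ = a ^+ N.+1 * b - a ^+ N); last by rewrite exprSr; ring.
by rewrite -e subrr; apply: prime0.
Qed.

(* [R/M] is a field because it is integral over the field [R0/(M :&: R0)]. *)
Lemma prime_invertible x : ~ M x -> exists u, M (u * x - 1).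
Proof.
move=> hx; have [p [p_monic [p_coef p_root]]] := hint x.
have hpx : M p.[x] by rewrite (eqP p_root); apply: prime0.
have hpM : exists i, ~ M p`_i.
  by exists (size p).-1; rewrite -lead_coefE (monicP p_monic); apply: prime1.
(* Monicity and the root are weakened to a coefficient outside [M] and a value in [M]. Both survive
   division by the variable when the constant term is in [M]; otherwise the constant term is
   invertible and yields an inverse of [x]. *)
clear p_monic p_root; elim/poly_ind: p p_coef hpx hpM => [|p c ih] p_coef hpx.
  by case=> i; rewrite coef0; case; apply: prime0.
have pc i : (p * 'X + c%:P)`_i.+1 = p`_i by rewrite coefD coefMX coefC addr0.
have p0 : (p * 'X + c%:P)`_0 = c by rewrite coefD coefMX coefC add0r.
move: hpx; rewrite hornerMXaddC => hpx [i hi].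
case: (pselect (M c)) => hc.
  have /prime_mul[h|//] : M (p.[x] * x) by rewrite -(addrK c (_ * _)); apply: primeB.
  apply: ih => //; first by move=> j; rewrite -pc.
  by case: i hi => [|i]; rewrite ?p0 ?pc // => hi; exists i.
have [|v hv hvc] := base_invertible _ hc; first by rewrite -p0.
exists (- v * p.[x]).
rewrite (_ : _ - 1 = (v * c - 1) - v * (p.[x] * x + c)); last by ring.
by apply: primeB => //; apply: primeM.
Qed.

Lemma fin_gen_prime_subalg s :
  fin_gen R0 (fun x => in_subalg R0 s x /\ M x).
Proof.
have [l hl] := in_subalg_lspan hR0 hint s.
apply: (@fin_gen_sub_lspan _ _ hR0 l); first exact: artinian_fin_gen.
  have hs := in_subalg_subring R0 s.
  split=> [|x y [h1 h2] [h3 h4]|a x ha [h1 h2]].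
  - by split; [apply: (subring0 hs) | apply: prime0].
  - by split; [apply: (subringD hs) | apply: primeD].
  - by split; [apply: (subringM hs) => //; apply: in_subalg_base | apply: primeM].
by move=> x [/hl].
Qed.

End ResidueField.

(** * Standard bases *)

Section ArtinianSeries.
Variables (R : comNzRingType) (R0 : R -> Prop) (n : nat).
Implicit Types (f g : pser R n) (I : pser R n -> Prop).

Local Notation S := (@artinian_series R R0 n).
Local Notation ideal := (is_ideal (@art_ps_ring R R0 n)).

Lemma artinian_series_mono s s' f : {subset s <= s'} ->
  (forall m, in_subalg R0 s (f m)) -> forall m, in_subalg R0 s' (f m).
Proof.
by move=> h hf m; apply: in_subalg_mono (hf m) => y /h; apply: in_subalg_gen.
Qed.

Lemma artinian_series2 f g : S f -> S g -> exists s,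
  (forall m, in_subalg R0 s (f m)) /\ (forall m, in_subalg R0 s (g m)).
Proof.
move=> [s hs] [t ht]; exists (s ++ t).
by split; [apply: artinian_series_mono hs | apply: artinian_series_mono ht] => y hy;
  rewrite mem_cat hy ?orbT.
Qed.

Lemma artinian_series_seq (T : eqType) (L : seq T) (h : T -> pser R n) :
  (forall a, a \in L -> S (h a)) ->
  exists s, forall a m, a \in L -> in_subalg R0 s (h a m).
Proof.
elim: L => [|a L ih] hL; first by exists [::].
have [s hs] := ih (fun b hb => hL b (mem_behead (s := a :: L) hb)).
have [t ht] := hL a (mem_head _ _).
exists (s ++ t) => b m; rewrite inE => /orP[/eqP ->|hb].
  by apply: artinian_series_mono ht m => y hy; rewrite mem_cat hy orbT.
apply: (@artinian_series_mono s _ (h b)) => [y hy|k]; first by rewrite mem_cat hy.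
exact: hs.
Qed.

Lemma artinian_series_subring : subring_P (S : pser R n -> Prop).
Proof.
split=> [|f g hf hg|f g hf hg].
- have hB := in_subalg_subring R0 [::]; exists [::] => m.
  rewrite /GRing.one /= /ps_one /ps_const.
  by case: eqP => _; [apply: (subring1 hB) | apply: (subring0 hB)].
- have [s [hs ht]] := artinian_series2 hf hg; exists s => m.
  by rewrite ps_coefB; apply: (subringB (in_subalg_subring R0 s)).
- have [s [hs ht]] := artinian_series2 hf hg; exists s => m.
  have hB := in_subalg_subring R0 s.
  by rewrite ps_coefM; apply: (subring_sum hB) => c _ _; apply: (subringM hB).
Qed.

Lemma artinian_series_modify f g : S f ->
  (forall m, [\/ g m = f m, g m = 0 | g m = 1]) -> S g.
Proof.
move=> [s hs] hg; exists s => m; have hB := in_subalg_subring R0 s.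
by case: (hg m) => ->; [| apply: (subring0 hB) | apply: (subring1 hB)].
Qed.

Lemma artinian_series_const r : S (psC r).
Proof.
exists [:: r] => m; rewrite ps_coefC; case: eqP => _.
  by apply: in_subalg_gen; rewrite inE.
by apply: (subring0 (in_subalg_subring R0 _)).
Qed.

Lemma artinian_series_monomial a : S (psX R a).
Proof.
apply: (@artinian_series_modify (0 : pser R n)) => [|m].
  exact: (subring0 artinian_series_subring).
by rewrite /psX; case: eqP; [constructor 3 | constructor 2].
Qed.

Section Ideals.
Variable I : pser R n -> Prop.
Hypothesis hI : ideal I.

Lemma ideal_car f : I f -> S f.
Proof. by case: hI => h _ _ _ _; apply: h. Qed.

Lemma ideal0 : I 0.
Proof. by case: hI. Qed.

Lemma idealD f g : I f -> I g -> I (f + g).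
Proof. by case: hI => _ _ _ h _; apply: h. Qed.

Lemma idealM f g : S f -> I g -> I (f * g).
Proof. by case: hI => _ _ _ _ h; apply: h. Qed.

Lemma idealN f : I f -> I (- f).
Proof.
rewrite -mulN1r; apply: idealM; apply: (subringN artinian_series_subring).
exact: (subring1 artinian_series_subring).
Qed.

Lemma idealB f g : I f -> I g -> I (f - g).
Proof. by move=> hf hg; apply: idealD => //; apply: idealN. Qed.

Lemma ideal_sum (T : eqType) (L : seq T) (F : T -> pser R n) :
  (forall a, a \in L -> I (F a)) -> I (\sum_(a <- L) F a).
Proof.
move=> h; rewrite big_seq; elim/big_ind: _ => //; first exact: ideal0.
exact: idealD.
Qed.

End Ideals.

Lemma series_ideal I :
  (forall f, I f -> S f) -> I 0 -> (forall f g, I f -> I g -> I (f + g)) ->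
  (forall f g, S f -> I g -> I (f * g)) -> ideal I.
Proof.
move=> hS h0 hD hM; split; [exact: hS | | exact: h0 | exact: hD | exact: hM].
by move=> f g _ /funext <-.
Qed.

Lemma sum_ideal I g : ideal I -> S g ->
  ideal (fun f : pser R n => exists p b : pser R n, [/\ I p, S b & f = p + b * g]).
Proof.
have hS := artinian_series_subring.
move=> hI hg; apply: series_ideal.
- move=> f [p [b [hp hb ->]]]; apply: (subringD hS); first exact: ideal_car hp.
  exact: (subringM hS).
- exists 0, 0; rewrite mul0r addr0; split=> //; first exact: ideal0.
  exact: (subring0 hS).
- move=> f f' [p [b [hp hb ->]]] [p' [b' [hp' hb' ->]]].
  exists (p + p'), (b + b'); split; [exact: idealD | exact: (subringD hS) | ring].
- move=> a f ha [p [b [hp hb ->]]]; exists (a * p), (a * b).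
  by split; [exact: idealM | exact: (subringM hS) | ring].
Qed.

End ArtinianSeries.

(** * The extended ideal MS and standard bases modulo M *)

Section Extension.
Variables (R : comNzRingType) (R0 : R -> Prop) (n : nat).
Hypothesis hR0 : subring_P R0.
Hypothesis artR0 : artinian (@ring_cr R R0).
Hypothesis hint : @integral_over R R0.
Variable M : R -> Prop.
Hypothesis M_prime : is_prime (@ring_cr R (fun _ => True)) M.
Implicit Types (f g : pser R n) (I : pser R n -> Prop).

Local Notation S := (@artinian_series R R0 n).
Local Notation ideal := (is_ideal (@art_ps_ring R R0 n)).

Definition coef_in f := forall m, M (f m).

Lemma coef_inD f g : coef_in f -> coef_in g -> coef_in (f + g).
Proof. by move=> hf hg m; apply: (primeD M_prime). Qed.

Lemma coef_inM f g : coef_in g -> coef_in (f * g).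
Proof.
move=> hg m; rewrite ps_coefM; apply: (prime_sum M_prime) => c _.
exact: (primeM M_prime).
Qed.

Lemma coef_in_ideal : ideal (fun f => S f /\ coef_in f).
Proof.
have hS := artinian_series_subring R0 n; apply: series_ideal.
- by move=> f [].
- by split; [exact: (subring0 hS) | move=> m; apply: (prime0 M_prime)].
- move=> f g [h1 h2] [h3 h4].
  by split; [exact: (subringD hS) | exact: coef_inD].
- move=> f g h1 [h3 h4].
  by split; [exact: (subringM hS) | exact: coef_inM].
Qed.

(** The coefficients of [f] lie in [M] and in one [R0[s]], hence in the [R0]-span of finitely many
    elements of [M]. Splitting each coefficient along these generators writes [f] as a finite sum of
    series over [R0] times constants from [M]. *)
Lemma ext_ideal_min I f : ideal I -> (forall r, M r -> I (psC r)) ->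
  S f -> coef_in f -> I f.
Proof.
move=> hI hMI [s hs] hf.
have [l [hl1 hl2]] := fin_gen_prime_subalg hR0 artR0 hint M_prime s.
have {hs hf hl2} : forall m, lspan R0 l (f m) by move=> m; apply: hl2.
have {hl1} : forall x, x \in l -> M x by move=> x /hl1[].
elim: l f => [|y l ih] f hl hf.
  have -> : f = 0 by apply: funext => m; apply: lspan_nil (hf m).
  exact: ideal0 hI.
have /choice[b hb] m : exists b, R0 b /\ lspan R0 l (f m - b * y).
  by have [b h1 h2] := lspan_cons hR0 (hf m); exists b.
pose g : pser R n := b.
rewrite -(subrK (g * psC y) f); apply: (idealD hI).
  apply: ih => [x hx|m]; first by apply: hl; rewrite inE hx orbT.
  by have [_] := hb m; rewrite ps_coefB [g * _]mulrC ps_coefCM mulrC.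
apply: (idealM hI); last by apply: hMI; apply: hl; rewrite mem_head.
by exists [::] => m; apply: in_subalg_base; have [] := hb m.
Qed.

Lemma ext_idealP f : ext_ideal R0 M f <-> S f /\ coef_in f.
Proof.
split=> [hf|[h1 h2] I hI hMI].
  apply: (hf (fun f => S f /\ coef_in f)); first exact: coef_in_ideal.
  move=> _ [r [hr ->]]; split; first exact: artinian_series_const.
  move=> m; rewrite -/(@psC R n r) ps_coefC; case: eqP => // _.
  exact: (prime0 M_prime).
by apply: ext_ideal_min => // r hr; apply: hMI; exists r.
Qed.

(** Turns vanishing modulo [M] into genuine vanishing, the form in which division measures order. *)
Lemma cut_series f : S f -> exists g, [/\ S g, coef_in (f - g)
  & forall m, M (f m) -> g m = 0].
Proof.
move=> hf; pose g : pser R n := fun m => if pselect (M (f m)) then 0 else f m.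
exists g; split.
- apply: artinian_series_modify hf _ => m; rewrite /g.
  by case: pselect; [constructor 2 | constructor 1].
- move=> m; rewrite ps_coefB /g; case: pselect => h; first by rewrite subr0.
  by rewrite subrr; apply: (prime0 M_prime).
- by move=> m h; rewrite /g; case: pselect.
Qed.

(** Scaling by an inverse of [f a] modulo [M] and changing coefficients within their classes makes
    the leading coefficient exactly 1 and all earlier ones exactly 0, as division demands. *)
Lemma normalize_lead f a : S f -> ~ M (f a) -> (forall b, mlt b a -> M (f b)) ->
  exists g, [/\ S g, g a = 1, (forall b, mlt b a -> g b = 0)
    & exists2 u : pser R n, S u & coef_in (g - u * f)].
Proof.
have hS := artinian_series_subring R0 n.
move=> hf /(prime_invertible hR0 artR0 hint M_prime)[u hu] hlow.
pose g : pser R n := fun b =>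
  if b == a then 1 else if mlt b a then 0 else (psC u * f) b.
have hu' := artinian_series_const R0 n u.
exists g; split.
- apply: (artinian_series_modify (f := psC u * f)); first exact: (subringM hS).
  move=> m; rewrite /g; case: eqP => _; first by constructor 3.
  by case: ifP => _; [constructor 2 | constructor 1].
- by rewrite /g eqxx.
- by move=> b hb; rewrite /g hb; case: eqP hb => // ->; rewrite mlt_irr.
- exists (psC u) => // b; rewrite ps_coefB /g; case: eqP => [->|_].
    rewrite ps_coefCM -[1 - _]opprB -mulN1r; exact: (primeM M_prime).
  case: ifP => [/hlow hb|_]; last by rewrite subrr; apply: (prime0 M_prime).
  by rewrite sub0r ps_coefCM -mulN1r; do 2 apply: (primeM M_prime).
Qed.

(* Standard basis: the leading monomials of the elements of [I] modulo [M] are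
   finitely generated by Dickson's lemma, and division leaves no remainder. *)
Lemma standard_basis I : ideal I -> (forall r, M r -> I (psC r)) ->
  exists (L : seq (mindex n)) (h : mindex n -> pser R n),
  (forall a, a \in L -> I (h a)) /\
  forall N f, I f -> (forall m, (tdeg m < N)%N -> M (f m)) ->
  exists q : mindex n -> pser R n, [/\ forall a, S (q a),
    (forall a c, (tdeg c + tdeg a < N)%N -> q a c = 0)
  & coef_in (f - \sum_(a <- L) q a * h a)].
Proof.
move=> hI hMI; have hS := artinian_series_subring R0 n.
have MI f : S f -> coef_in f -> I f by apply: ext_ideal_min.
pose lead a := exists h, [/\ I h, h a = 1 & forall b, mlt b a -> h b = 0].
have [L [hL1 hL2]] := dickson lead.
have /choice[h hh] a : exists h, a \in undup L ->
    [/\ I h, h a = 1 & forall b, mlt b a -> h b = 0].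
  case: (boolP (a \in L)) => [/hL1[h ha]|ha]; first by exists h.
  by exists 0; rewrite mem_undup (negbTE ha).
have hhI a : a \in undup L -> I (h a) by case/hh.
exists (undup L), h; split=> // N f hf hfN.
have [s hs] := artinian_series_seq (fun a ha => ideal_car hI (hhI a ha)).
have [f' [hf'S hff' hf'0]] := cut_series (ideal_car hI hf).
have hf'I : I f'.
  rewrite (_ : f' = f - (f - f')); last by rewrite subKr.
  apply: (idealB hI) => //; apply: MI => //.
  by apply: (subringB hS) => //; apply: ideal_car hf.
case: (hf'S) => s' hs'; pose B := in_subalg R0 (s ++ s').
have hB : subring_P B := in_subalg_subring R0 _.
have sub_s : {subset s <= s ++ s'} by move=> x hx; rewrite mem_cat hx.
have sub_s' : {subset s' <= s ++ s'} by move=> x hx; rewrite mem_cat hx orbT.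
have [| | | |q [r [e [hqB hrB] hr hqN]]] :=
    @power_series_division R n B (undup L) h hB (undup_uniq L) _ _ _ f'.
- by move=> a /hh[].
- by move=> a b /hh[_ _]; apply.
- move=> a b ha; apply: in_subalg_mono (hs a b ha) => y /sub_s.
  exact: in_subalg_gen.
- exact: artinian_series_mono hs'.
have hq a : S (q a) by exists (s ++ s'); apply: hqB.
exists q; split=> //.
  by apply: hqN => m hm; apply: hf'0; apply: hfN.
have hrI : I r.
  rewrite (_ : r = f' - \sum_(a <- undup L) q a * h a); last first.
    by rewrite e addrAC subrr add0r.
  apply: (idealB hI) => //; apply: (ideal_sum hI) => a ha.
  by apply: (idealM hI) => //; apply: hhI.
have -> : f - \sum_(a <- undup L) q a * h a = (f - f') + r.
  by rewrite [X in _ - X + _]e; ring.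
(* Were a coefficient of the remainder outside [M], its least such exponent would be the exponent of
   a normalised element of [I], hence divisible by an element of [L], where the remainder
   vanishes. *)
apply: coef_inD => // m; apply: contrapT => hm.
have [a ha hamin] := exists_mlt_min (P := fun m => ~ M (r m)) hm.
have hamin' b : mlt b a -> M (r b) by move=> /hamin; apply: contrapT.
have [g [hg1 hg2 hg3 [u hu hug]]] := normalize_lead (ideal_car hI hrI) ha hamin'.
have [|a' ha' haa'] := hL2 a.
  exists g; split=> //; rewrite -(subrK (u * r) g); apply: (idealD hI).
    apply: MI => //; apply: (subringB hS) => //; apply: (subringM hS) => //.
    exact: ideal_car hrI.
  exact: (idealM hI).
by apply: ha; rewrite (hr a a') ?mem_undup //; apply: (prime0 M_prime).
Qed.

End Extension.

(** * Chains of primes *)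

Section DimensionBound.
Variables (R : comNzRingType) (R0 : R -> Prop) (n : nat).
Hypothesis hR0 : subring_P R0.
Hypothesis artR0 : artinian (@ring_cr R R0).
Hypothesis hint : @integral_over R R0.
Variable M : R -> Prop.
Hypothesis M_prime : is_prime (@ring_cr R (fun _ => True)) M.
Implicit Types (f g : pser R n) (I P : pser R n -> Prop).

Local Notation S := (@artinian_series R R0 n).
Local Notation ideal := (is_ideal (@art_ps_ring R R0 n)).
Local Notation prime := (is_prime (@art_ps_ring R R0 n)).

Let hS : subring_P (S : pser R n -> Prop) := artinian_series_subring R0 n.

Definition order_ge N f := forall m, (tdeg m < N)%N -> M (f m).

Lemma order_ge_eq N f g : f = g -> order_ge N f -> order_ge N g.
Proof. by move->. Qed.

Lemma order_ge_mono N N' f : (N' <= N)%N -> order_ge N f -> order_ge N' f.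
Proof. by move=> hN hf m hm; apply: hf; apply: leq_trans hm hN. Qed.

Lemma mle_tdeg (a b : mindex n) : mle a b -> (tdeg a <= tdeg b)%N.
Proof. by move=> /mleP h; apply: leq_sum => i _; apply: h. Qed.

Lemma prime_ideal P : prime P -> ideal P.
Proof. by case=> [[]]. Qed.

(** Division of [a x - p] by a standard basis of [P + S x] loses at most [c], the largest degree of
    a leading monomial. Each basis element is [b d * x] modulo [P]; with [w] the sum of the
    [q d * b d], the product [(a - w) x] is in [P], so [a - w] is, and [w] has order at least
    [N]. *)
Lemma artin_rees P (x : pser R n) :
  prime P -> (forall r, M r -> P (psC r)) -> S x -> ~ P x ->
  exists c, forall N (a : pser R n), S a ->
    (exists2 p : pser R n, P p & order_ge (N + c) (a * x - p)) ->
    exists2 p : pser R n, P p & order_ge N (a - p).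
Proof.
move=> hP hMP hx hPx; have hPI := prime_ideal hP.
have [|L [h [hL hdiv]]] :=
    standard_basis hR0 artR0 hint M_prime (sum_ideal hPI hx).
  move=> r hr; exists (psC r), 0; rewrite mul0r addr0; split=> //.
    exact: hMP.
  exact: (subring0 hS).
exists (\max_(a <- L) tdeg a)%N => N a ha [p hp hord].
have /choice[b hb] d : exists b : pser R n, d \in L -> S b /\ P (h d - b * x).
  case: (boolP (d \in L)) => [/hL[p' [b [h1 h2 ->]]]|_]; last by exists 0.
  by exists b; rewrite addrK.
have hy : exists p' b : pser R n, [/\ P p', S b & a * x - p = p' + b * x].
  exists (- p), a; split=> //; first exact: (idealN hPI).
  by rewrite addrC.
have [q [hq1 hq2 hq3]] := hdiv _ _ hy hord.
pose w := \sum_(d <- L) q d * b d.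
have hw : S w.
  by apply: (subring_sum hS) => d hd _; apply: (subringM hS) => //; case: (hb d hd).
have hzx : P ((a - w) * x).
  have -> : (a - w) * x = (a * x - p - \sum_(d <- L) q d * h d) + p
      + \sum_(d <- L) q d * (h d - b d * x).
    rewrite (_ : \sum_(d <- L) q d * (h d - b d * x) =
      \sum_(d <- L) q d * h d - w * x); first by ring.
    rewrite /w mulr_suml -sumrB; apply: eq_bigr => d _; ring.
  apply: (idealD hPI); first apply: (idealD hPI) => //.
    apply: (ext_ideal_min hR0 artR0 hint M_prime) => //.
    apply: (subringB hS).
      apply: (subringB hS); first exact: (subringM hS).
      exact: ideal_car hPI _ hp.
    apply: (subring_sum hS) => d hd _; apply: (subringM hS) => //.
    exact: ideal_car (sum_ideal hPI hx) _ (hL d hd).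
  apply: (ideal_sum hPI) => d hd; apply: (idealM hPI) => //.
  by case: (hb d hd).
exists (a - w).
  case: hP => _ hP; case: (hP (a - w) x _ hx hzx) => //.
  exact: (subringB hS).
rewrite subKr => m hm; rewrite /w ps_coef_sum big_seq.
apply: (prime_sum M_prime) => d hd; rewrite ps_coefM big_seq.
apply: (prime_sum M_prime) => c; rewrite mem_below => /mle_tdeg hc.
rewrite hq2 ?mul0r; first exact: (prime0 M_prime).
apply: leq_ltn_trans (_ : _ <= tdeg m + \max_(a <- L) tdeg a)%N _.
  by rewrite leq_add // (big_rem d) //= leq_maxl.
by rewrite ltn_add2r.
Qed.

(** Linear independence over the field [R/M] in [S/P] modulo order [N], phrased with representatives
    in [R]. *)
Definition independent P N (T : finType) (y : T -> pser R n) :=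
  forall b : T -> R,
    (exists2 p : pser R n, P p & order_ge N (\sum_t psC (b t) * y t - p)) ->
  forall t, M (b t).

(** Since [x] is in [P'], a relation read modulo [P'] involves only the terms with [e = 0], whose
    coefficients are therefore in [M]. The rest is divisible by [x], which the Artin-Rees bound
    cancels at the cost of [c] orders; then induction on [E]. *)
Lemma independent_powers P P' (x : pser R n) c N (T : finType) (y : T -> pser R n) :
  ideal P -> ideal P' -> (forall r, M r -> P (psC r)) ->
  subI (art_ps_ring R0 n) P P' -> P' x ->
  (forall N (a : pser R n), S a ->
    (exists2 p : pser R n, P p & order_ge (N + c) (a * x - p)) ->
    exists2 p : pser R n, P p & order_ge N (a - p)) ->
  (forall t, S (y t)) -> independent P' N y ->
  forall E, independent P (N + c * E) (fun te : T * 'I_E => x ^+ te.2 * y te.1).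
Proof.
move=> hP hP' hMP hPP' hx' hc hy hind E.
have hx : S x := ideal_car hP' hx'.
suff H : forall b : T -> nat -> R,
    (exists2 p : pser R n, P p & order_ge (N + c * E)
      (\sum_t \sum_(e < E) psC (b t e) * (x ^+ e * y t) - p)) ->
    forall t e, (e < E)%N -> M (b t e).
  move=> b [p hp hord] [t e].
  (* Coefficients indexed by all naturals, zero out of range, make the shift from [e] to [e.+1]
     harmless. *)
  pose b' t k := if insub k is Some e then b (t, e) else 0.
  have b'E t' (e' : 'I_E) : b' t' e' = b (t', e') by rewrite /b' valK.
  rewrite -b'E; apply: H (ltn_ord e); exists p => //.
  apply: order_ge_eq hord; congr (_ - _); rewrite pair_bigA /=.
  by apply: eq_bigr => -[t' e'] _; rewrite b'E.
elim: E => [//|E ih] b [p hp hord].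
have hSum : S (\sum_t \sum_(e < E) psC (b t e.+1) * (x ^+ e * y t)).
  do 2 (apply: (subring_sum hS) => ? _ _).
  apply: (subringM hS); first exact: artinian_series_const.
  apply: (subringM hS) => //; elim: (nat_of_ord _) => [|k ihk].
    exact: (subring1 hS).
  by rewrite exprS; apply: (subringM hS).
have e1 : \sum_t \sum_(e < E.+1) psC (b t e) * (x ^+ e * y t) =
    \sum_t psC (b t 0%N) * y t +
    (\sum_t \sum_(e < E) psC (b t e.+1) * (x ^+ e * y t)) * x.
  rewrite mulr_suml -big_split; apply: eq_bigr => t _.
  rewrite big_ord_recl mul1r; congr (_ + _); rewrite mulr_suml.
  by apply: eq_bigr => e _; rewrite lift0 exprS; ring.
have h0 : forall t, M (b t 0%N).
  apply: hind; exists (p - (\sum_t \sum_(e < E) psC (b t e.+1) * (x ^+ e * y t)) * x).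
    by apply: (idealB hP'); [apply: hPP' | apply: (idealM hP')].
  apply: (@order_ge_mono (N + c * E.+1)); first exact: leq_addr.
  by apply: order_ge_eq hord; rewrite e1; ring.
have h1 : exists2 p : pser R n, P p & order_ge (N + c * E)
    (\sum_t \sum_(e < E) psC (b t e.+1) * (x ^+ e * y t) - p).
  apply: hc => //; exists (p - \sum_t psC (b t 0%N) * y t).
    apply: (idealB hP) => //; apply: (ideal_sum hP) => t _.
    by rewrite mulrC; apply: (idealM hP) => //; apply: hMP.
  rewrite -addnA -mulnSr; apply: order_ge_eq hord; rewrite e1; ring.
move=> t [//|e]; rewrite ltnS => he; exact: (ih (fun t e => b t e.+1) h1 t e he).
Qed.

(** Gaussian elimination over [R/M], with one equation for each [j] in [js] and one unknown for each
    [t] in [X]. *)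
Lemma mod_prime_dependence (T : finType) (J : eqType) (A : T -> J -> R)
    (js : seq J) (X : {set T}) : (size js < #|X|)%N ->
  exists b : T -> R, (exists2 t, t \in X & ~ M (b t)) /\
    forall j, j \in js -> M (\sum_(t in X) b t * A t j).
Proof.
elim: js X A => [|j js ih] X A hX.
  have [t ht] : exists t, t \in X by apply/set0Pn; rewrite -card_gt0.
  by exists (fun=> 1); split=> //; exists t => //; apply: (prime1 M_prime).
case: (pselect (exists2 t0, t0 \in X & ~ M (A t0 j))) => [[t0 ht0 hA]|hA]; last first.
  have [b [hb1 hb2]] := ih X A (ltnW hX); exists b; split=> // k.
  rewrite inE => /orP[/eqP ->|]; last exact: hb2.
  apply: (prime_sum M_prime) => t ht; apply: (primeM M_prime).
  by apply: contrapT => h; apply: hA; exists t.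
have [u hu] := prime_invertible hR0 artR0 hint M_prime hA.
(* The pivot [t0] is eliminated from the other equations; [b' t0] is then chosen to solve equation
   [j] modulo [M]. *)
pose A' t k := A t k - u * A t j * A t0 k.
have [|b [[t ht hbt] hb]] := ih (X :\ t0) A'.
  by move: hX; rewrite (cardsD1 t0 X) ht0.
pose b' t := if t == t0 then - \sum_(t in X :\ t0) b t * (u * A t j) else b t.
have hsum k : \sum_(t in X) b' t * A t k = \sum_(t in X :\ t0) b t * A' t k.
  rewrite (big_setD1 t0) //= {1}/b' eqxx mulNr mulr_suml -sumrN -big_split /=.
  apply: eq_bigr => s; rewrite in_setD1 => /andP[/negbTE hs _].
  by rewrite /b' hs /A'; ring.
exists b'; split.
  move: ht; rewrite in_setD1 => /andP[/negbTE ht0' htX].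
  by exists t => //; rewrite /b' ht0'.
move=> k; rewrite hsum inE => /orP[/eqP ->|]; last exact: hb.
apply: (prime_sum M_prime) => s _.
rewrite (_ : _ * _ = - (b s * A s j) * (u * A t0 j - 1)); last by rewrite /A'; ring.
exact: (primeM M_prime).
Qed.

(** Monomials of degree below [N] lie in a box with [N ^ n] points, so there are fewer linear
    conditions than unknowns. *)
Lemma dependent_series N (T : finType) (y : T -> pser R n) : (N ^ n < #|T|)%N ->
  exists2 b : T -> R, (exists t, ~ M (b t)) & order_ge N (\sum_t psC (b t) * y t).
Proof.
move=> hT.
pose js : seq (mindex n) := [seq [ffun i => (d i : nat)] | d : {ffun 'I_n -> 'I_N}].
have [|b [[t _ hbt] hb]] := @mod_prime_dependence T _ (fun t m => y t m) js [set: T].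
  by rewrite size_map -cardT card_ffun !card_ord cardsT.
exists b; first by exists t.
move=> m hm; rewrite ps_coef_sum.
have hb' i : (m i < N)%N by apply: leq_ltn_trans (mle_deg m i) hm.
have e : \sum_(t in [set: T]) b t * y t m = \sum_t (psC (b t) * y t) m.
  by apply: eq_big => [s|s _]; rewrite ?inE ?ps_coefCM.
rewrite -e; apply: hb; apply/mapP.
exists [ffun i => Ordinal (hb' i)]; first by rewrite mem_enum.
by apply/ffunP => i; rewrite !ffunE.
Qed.

(** After normalisation, dividing 1 by a series with leading monomial 1 leaves no remainder, because
    that monomial divides all others. *)
Lemma unit_in_ideal I f : ideal I -> (forall r, M r -> I (psC r)) ->
  I f -> ~ M (f (mone n)) -> I 1.
Proof.
move=> hI hMI hf hf0.
have low b : mlt b (mone n) -> False.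
  move=> hb; have := mlt_deg hb; rewrite tdeg1 leqn0 => /eqP /tdeg_eq0 e.
  by move: hb; rewrite e mlt_irr.
have [|g [hgS hg1 hg0 [u hu hug]]] :=
    normalize_lead hR0 artR0 hint M_prime (ideal_car hI hf) hf0.
  by move=> b /low.
have hgI : I g.
  rewrite -(subrK (u * f) g); apply: (idealD hI); last exact: (idealM hI).
  apply: (ext_ideal_min hR0 artR0 hint M_prime) => //; apply: (subringB hS) => //.
  by apply: (subringM hS) => //; apply: ideal_car hI _ hf.
have [s [hs1 hs2]] := artinian_series2 hgS (subring1 hS).
have [| | | | |q [r [e [hqB _] hr _]]] := @power_series_division R n (in_subalg R0 s)
    [:: mone n] (fun=> g) (in_subalg_subring R0 s) _ _ _ _ 1 => //.
- by move=> a; rewrite inE => /eqP ->.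
- by move=> a b; rewrite inE => /eqP -> /low.
have r0 : r = 0.
  by apply: funext => m; rewrite (hr m (mone n)) ?inE ?mle1.
move: e; rewrite big_seq1 r0 addr0 => ->; apply: (idealM hI) => //.
by exists s; apply: hqB.
Qed.

Lemma no_long_prime_chain (P : nat -> pser R n -> Prop) :
  (forall r, M r -> P 0%N (psC r)) -> ~ prime_chain (art_ps_ring R0 n) n.+1 P.
Proof.
move=> hMP0 [hprime hlt].
have hsub i j : (i <= j)%N -> (j <= n.+1)%N -> subI (art_ps_ring R0 n) (P i) (P j).
  move=> /subnK <-; elim: (j - i)%N => [|k ih] hk f hf //.
  by case: (hlt (k + i)%N hk) => h _; apply: h; apply: ih => //; apply: ltnW.
have hMP i : (i <= n.+1)%N -> forall r, M r -> P i (psC r).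
  by move=> hi r hr; apply: (hsub 0%N) => //; apply: hMP0.
have /choice[x hx] i : exists x : pser R n, (i <= n)%N -> P i.+1 x /\ ~ P i x.
  case: (leqP i n) => hi; last by exists 0.
  by case: (hlt i hi) => _ [x hx]; exists x.
have /choice[c hc] i : exists c, (i <= n)%N -> forall N (a : pser R n), S a ->
    (exists2 p : pser R n, P i p & order_ge (N + c) (a * x i - p)) ->
    exists2 p : pser R n, P i p & order_ge N (a - p).
  case: (leqP i n) => hi; last by exists 0%N.
  have [h1 h2] := hx i hi.
  have h3 := ideal_car (prime_ideal (hprime i.+1 hi)) h1.
  have [c hc] := artin_rees (hprime i (leqW hi)) (hMP i (leqW hi)) h3 h2.
  by exists c.
(* One Artin-Rees constant valid for every link of the chain. *)
pose D := (\sum_(i < n.+1) c i)%N.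
have hD i N (a : pser R n) : (i <= n)%N -> S a ->
    (exists2 p : pser R n, P i p & order_ge (N + D) (a * x i - p)) ->
    exists2 p : pser R n, P i p & order_ge N (a - p).
  move=> hi ha [p hp hord]; apply: hc => //; exists p => //.
  apply: order_ge_mono hord; rewrite leq_add2l /D.
  by rewrite (bigD1 (Ordinal (hi : (i < n.+1)%N))) //= leq_addr.
(* The family is built downwards from the top prime, each link multiplying its size by [E] and
   raising the order by [D * E]. It starts with the series 1, independent up to order 1 because
   members of the top prime have constant term in [M]. *)
have family E k : (k <= n.+1)%N -> exists (T : finType) (y : T -> pser R n),
    [/\ #|T| = (E ^ k)%N, (forall t, S (y t))
      & independent (P (n.+1 - k)%N) (1 + D * E * k) y].
  elim: k => [_|k ih hk].
    exists unit, (fun=> 1); split; first by rewrite card_unit.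
      by move=> _; apply: (subring1 hS).
    rewrite subn0 muln0 addn0 => b [p hp hord] [].
    rewrite (bigD1 tt) //= big1 ?addr0 ?mulr1 in hord; last by case.
    have hp0 : M (p (mone n)).
      apply: contrapT => hp0; have [[_ h] _] := hprime n.+1 (leqnn _); apply: h.
      exact: unit_in_ideal (prime_ideal (hprime n.+1 (leqnn _))) (hMP _ _) hp hp0.
    have := hord (mone n); rewrite tdeg1 ps_coefB ps_coefC eqxx => /(_ isT) h.
    by rewrite -(subrK (p (mone n)) (b tt)); apply: (primeD M_prime).
  have [T [y [hT hy hind]]] := ih (ltnW hk).
  pose i := (n.+1 - k.+1)%N.
  have hi : (i <= n)%N by rewrite /i subSS leq_subr.
  have ei : (n.+1 - k)%N = i.+1 by rewrite /i subnSK.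
  rewrite ei in hind.
  have [h1 h2] := hx i hi.
  exists (T * 'I_E)%type, (fun te : T * 'I_E => x i ^+ te.2 * y te.1); split.
  - by rewrite card_prod hT card_ord expnSr.
  - move=> [t e] /=; apply: (subringM hS) => //; elim: (nat_of_ord e) => [|j ihj].
      exact: (subring1 hS).
    rewrite exprS; apply: (subringM hS) => //.
    exact: ideal_car (prime_ideal (hprime i.+1 hi)) _ h1.
  - rewrite mulnS [(D * E + _)%N]addnC addnA.
    apply: (@independent_powers (P i) (P i.+1)) => //.
    + exact/prime_ideal/hprime/leqW.
    + exact/prime_ideal/hprime.
    + exact/hMP/leqW.
    + by apply: hsub.
    + by move=> N a; apply: hD.
(* The final order is at most [C * E], and [E > C ^ n] gives [(C * E) ^ n < E ^ n.+1]: more series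
   than dimensions. *)
pose C := (D * n.+1 + 1)%N.
pose E := (C ^ n).+1.
have [T [y [hT hy hind]]] := family E n.+1 (leqnn _).
have [|b [t ht] hb] := @dependent_series (1 + D * E * n.+1) T y.
  rewrite hT; apply: (@leq_ltn_trans ((C * E) ^ n)).
    have leX a b k : (a <= b -> a ^ k <= b ^ k)%N.
      by case: k => [//|k] hab; rewrite leq_exp2r.
    by apply: leX; rewrite /C mulnDl mul1n addnC leq_add // mulnAC.
  by rewrite expnMn expnS ltn_mul2r expn_gt0 /E /=.
apply: ht; apply: hind; rewrite subnn; exists 0; last by rewrite subr0.
exact: ideal0 (prime_ideal (hprime _ _)).
Qed.

End DimensionBound.

(** * The residue rings *)

Section CoordinatePrimes.
Variables (R : comNzRingType) (R0 : R -> Prop) (n : nat).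
Variable M : R -> Prop.
Hypothesis M_prime : is_prime (@ring_cr R (fun _ => True)) M.
Implicit Types (f g : pser R n) (m : mindex n).

Local Notation S := (@artinian_series R R0 n).

Let hS : subring_P (S : pser R n -> Prop) := artinian_series_subring R0 n.

Definition avoids k m := forall j : 'I_n, (j < k)%N -> m j = 0%N.

(* The series whose coefficients at the monomials in [X_(k+1), ..., X_n] lie
   in [M], that is, the ideal generated by [M] and [X_1, ..., X_k]. *)
Definition coordinate_prime k f := S f /\ forall m, avoids k m -> M (f m).

Definition munit (i : 'I_n) : mindex n := [ffun j => (j == i : nat)].

Lemma avoids_le k a b : mle a b -> avoids k b -> avoids k a.
Proof.
by move=> /mleP h hb j hj; apply/eqP; rewrite -leqn0 -(hb j hj); apply: h.
Qed.

Lemma avoids_mone k : avoids k (mone n).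
Proof. by move=> j _; rewrite ffunE. Qed.

(** At the product of the two least exponents [a] and [b] with coefficient outside [M], every other
    term has a factor at an earlier exponent, hence in [M]. Divisors inherit [avoids k], so
    minimality applies to them. *)
Lemma product_coef_notin k f g :
  (exists2 m, avoids k m & ~ M (f m)) -> (exists2 m, avoids k m & ~ M (g m)) ->
  exists2 m, avoids k m & ~ M ((f * g) m).
Proof.
move=> [mf kf hf] [mg kg hg].
have [a [ka ha] amin] :=
  exists_mlt_min (P := fun m => avoids k m /\ ~ M (f m)) (conj kf hf).
have [b [kb hb] bmin] :=
  exists_mlt_min (P := fun m => avoids k m /\ ~ M (g m)) (conj kg hg).
have kab : avoids k (madd a b) by move=> j hj; rewrite ffunE ka ?kb.
exists (madd a b) => //; rewrite ps_coefM.
rewrite (bigD1_seq a) ?below_uniq ?mem_below 1?maddC ?mle_add //= maddK => hM.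
have h1 : M (f a * g b).
  rewrite -(addrK (\sum_(i <- below (madd b a) | i != a) f i * g (msub (madd b a) i))
    (f a * g b)).
  apply: (primeB M_prime) => //; rewrite big_seq_cond.
  apply: (prime_sum M_prime) => c /andP[]; rewrite mem_below maddC => hc.
  have [h|->|h] := mlt_total c a; last 1 first.
  - move=> _; apply: (primeM M_prime); apply: contrapT => hgc.
    have h' : mlt (msub (madd a b) c) b.
      by rewrite -(mlt_add2r c) msubK // [madd b c]maddC mlt_add2r.
    by case: (bmin _ h'); split=> //; apply: avoids_le kab; apply: mle_sub.
  - move=> _; rewrite mulrC; apply: (primeM M_prime); apply: contrapT => hfc.
    by case: (amin _ h); split=> //; apply: avoids_le hc kab.
  - by rewrite eqxx.
by case: (prime_mul M_prime h1).
Qed.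

Lemma coordinate_prime_prime k : is_prime (art_ps_ring R0 n) (coordinate_prime k).
Proof.
split; first split.
- apply: series_ideal.
  + by move=> f [].
  + by split=> [|m _]; [apply: (subring0 hS) | apply: (prime0 M_prime)].
  + move=> f g [hf hf'] [hg hg']; split; first exact: (subringD hS).
    by move=> m hm; apply: (primeD M_prime); [apply: hf' | apply: hg'].
  + move=> f g hf [hg hg']; split; first exact: (subringM hS).
    move=> m hm; rewrite ps_coefM; apply: (prime_sum M_prime) => c _.
    by apply: (primeM M_prime); apply: hg'; apply: avoids_le hm; apply: mle_sub.
- move=> [_ /(_ (mone n))]; rewrite /= /ps_one /ps_const eqxx => h.
  by apply: (prime1 M_prime); apply: h; apply: avoids_mone.
move=> f g hf hg [hfg hfg'].
have key (h : pser R n) : S h -> ~ coordinate_prime k h ->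
    exists2 m, avoids k m & ~ M (h m).
  move=> hh hn; apply: contrapT => hm; apply: hn; split=> // m hkm.
  by apply: contrapT => hm'; apply: hm; exists m.
apply: contrapT => h.
case: (@product_coef_notin k f g).
- by apply: key => // h'; apply: h; left.
- by apply: key => // h'; apply: h; right.
by move=> m hkm; apply; apply: hfg'.
Qed.

Lemma coordinate_prime_chain : prime_chain (art_ps_ring R0 n) n coordinate_prime.
Proof.
split=> [i _|i hi]; first exact: coordinate_prime_prime.
split=> [f [hf hf']|].
  by split=> // m hm; apply: hf' => j hj; apply: hm; apply: leqW.
(* The variable of index [i], counted from 0, separates consecutive primes. *)
exists (psX R (munit (Ordinal hi))); split.
  split=> [|m hm]; first exact: artinian_series_monomial.
  rewrite /psX; case: eqP => [e|_]; last exact: (prime0 M_prime).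
  by have := hm (Ordinal hi) (leqnn _); rewrite e ffunE eqxx.
move=> [_ /(_ (munit (Ordinal hi)))]; rewrite /psX eqxx => h.
apply: (prime1 M_prime); apply: h => j hj; rewrite ffunE; case: eqP => // e.
by rewrite e ltnn in hj.
Qed.

Lemma coordinate_prime_const k r : M r -> coordinate_prime k (psC r).
Proof.
move=> hr; split; first exact: artinian_series_const.
by move=> m _; rewrite ps_coefC; case: eqP => // _; apply: (prime0 M_prime).
Qed.

Lemma coordinate_prime_max f : coordinate_prime n f <-> S f /\ M (f (mone n)).
Proof.
split=> [[hf hf']|[hf hf']]; split=> //; first by apply: hf'; apply: avoids_mone.
move=> m hm; rewrite (_ : m = mone n) //; apply/ffunP => j.
by rewrite ffunE hm.
Qed.

End CoordinatePrimes.

(** * Dimension and regularity of S/MS, and minimality of MS *)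

Section Quotient.
Variables (R : comNzRingType) (R0 : R -> Prop) (n : nat).
Hypothesis hR0 : subring_P R0.
Hypothesis artR0 : artinian (@ring_cr R R0).
Hypothesis hint : @integral_over R R0.
Variable M : R -> Prop.
Hypothesis M_prime : is_prime (@ring_cr R (fun _ => True)) M.
Implicit Types (f g : pser R n) (J : pser R n -> Prop).

Local Notation S := (@artinian_series R R0 n).
Local Notation A := (@art_ps_ring R R0 n).
Local Notation Q := (@quot_cring R R0 n (@ext_ideal R R0 n M)).
Local Notation coordinate_prime := (@coordinate_prime R R0 n M).

Let hS : subring_P (S : pser R n -> Prop) := artinian_series_subring R0 n.

Let ext_idealP f : ext_ideal R0 M f <-> S f /\ coef_in M f.
Proof. exact: ext_idealP. Qed.

(** The quotient keeps the carrier and coarsens equality; stability under that equality amounts to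
    containing [MS]. *)
Lemma quot_ideal J :
  is_ideal Q J <-> is_ideal A J /\ forall r, M r -> J (psC r).
Proof.
split=> [[h1 h2 h3 h4 h5]|[hJ hMJ]].
  have hJ : is_ideal A J by apply: series_ideal.
  split=> // r hr; apply: (h2 (0 : pser R n)) => //; first exact: artinian_series_const.
  change (ext_ideal R0 M (0 - psC r : pser R n)); apply/ext_idealP; split.
    by apply: (subringB hS); [apply: (subring0 hS) | apply: artinian_series_const].
  move=> m; rewrite ps_coefB; apply: (primeB M_prime); first exact: (prime0 M_prime).
  by rewrite ps_coefC; case: eqP => // _; apply: (prime0 M_prime).
split; [exact: ideal_car hJ | | exact: ideal0 hJ | exact: idealD hJ | exact: idealM hJ].
move=> f g _ /ext_idealP[h1 h2] hf.
rewrite -[g](subKr (f : pser R n) (g : pser R n)).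
by apply: (idealB hJ) => //; apply: (ext_ideal_min hR0 artR0 hint M_prime).
Qed.

Lemma quot_proper J :
  proper_ideal Q J <-> proper_ideal A J /\ forall r, M r -> J (psC r).
Proof.
split=> [[/quot_ideal[h1 h2] h3]|[[h1 h3] h2]]; first by split.
by split=> //; apply/quot_ideal.
Qed.

Lemma quot_prime J :
  is_prime Q J <-> is_prime A J /\ forall r, M r -> J (psC r).
Proof.
split=> [[/quot_proper[h1 h2] h3]|[[h1 h3] h2]]; first by split.
by split=> //; apply/quot_proper.
Qed.

Lemma ext_ideal_coordinate f : ext_ideal R0 M f <-> coordinate_prime 0 f.
Proof.
split=> [/ext_idealP[h1 h2]|[h1 h2]]; first by split=> // m _; apply: h2.
by apply/ext_idealP; split=> // m; apply: h2.
Qed.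

Lemma quot_krull_dim : krull_dim Q n.
Proof.
split.
  have [h1 h2] := @coordinate_prime_chain R R0 n M M_prime.
  exists coordinate_prime; split=> // i hi; apply/quot_prime; split; first exact: h1.
  exact: coordinate_prime_const.
move=> [P [h1 h2]].
apply: (no_long_prime_chain hR0 artR0 hint M_prime (P := P)).
  by case/quot_prime: (h1 0%N (leq0n _)).
by split=> // i /h1 /quot_prime[].
Qed.

Lemma quot_noetherian : noetherian Q.
Proof.
move=> I hI hsub.
have mono i j f : (i <= j)%N -> I i f -> I j f.
  by move=> /subnK <-; elim: (j - i)%N => // k ih /ih; apply: hsub.
have hIA i := (quot_ideal (I i)).1 (hI i).
pose U f := exists i, I i f.
have hU : is_ideal A U.
  apply: series_ideal.
  - by move=> f [i hf]; apply: ideal_car (hIA i).1 _ hf.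
  - by exists 0%N; apply: ideal0 (hIA 0%N).1.
  - move=> f g [i hf] [j hg]; exists (maxn i j); apply: (idealD (hIA _).1).
      by apply: mono hf; rewrite leq_maxl.
    by apply: mono hg; rewrite leq_maxr.
  - by move=> f g hf [i hg]; exists i; apply: (idealM (hIA i).1).
have hMU r : M r -> U (psC r) by move=> hr; exists 0%N; apply: (hIA 0%N).2.
have [L [h [hL hdiv]]] := standard_basis hR0 artR0 hint M_prime hU hMU.
have [N hN] : exists N, forall a, a \in L -> I N (h a).
  by apply: seq_eventually hL => i j a; apply: mono.
exists N => k hk; split=> f hf; last exact: mono hf.
(* The standard basis of the union already lies in [I N]; at order 0 the order condition is
   vacuous. *)
have [q [hq _ hr]] := hdiv 0%N f (ex_intro _ k hf) (fun m => ltac:(by [])).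
have hsum : I N (\sum_(a <- L) q a * h a).
  by apply: (ideal_sum (hIA N).1) => a /hN; apply: (idealM (hIA N).1).
rewrite -(subrK (\sum_(a <- L) q a * h a) (f : pser R n)).
apply: (idealD (hIA N).1) => //.
apply: (ext_ideal_min hR0 artR0 hint M_prime (hIA N).1 (hIA N).2) => //.
apply: (subringB hS); first exact: ideal_car (hIA k).1 _ hf.
exact: ideal_car (hIA N).1 _ hsum.
Qed.

Lemma quot_proper_sub_max J : proper_ideal Q J -> forall f, J f -> coordinate_prime n f.
Proof.
move=> /quot_proper[[hJ hJ1] hMJ] f hf; apply/coordinate_prime_max.
split; first exact: ideal_car hJ _ hf.
apply: contrapT => hf0; apply: hJ1.
exact: (unit_in_ideal hR0 artR0 hint M_prime hJ hMJ hf hf0).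
Qed.

Lemma quot_local : is_local_with Q (coordinate_prime n).
Proof.
have hm : proper_ideal Q (coordinate_prime n).
  apply/quot_proper; split; last exact: coordinate_prime_const.
  by case: (coordinate_prime_prime R0 n M_prime n).
split; first by split=> // J hJ _; apply: quot_proper_sub_max.
move=> J [hJ hJmax]; split; first exact: quot_proper_sub_max.
by apply: hJmax => //; apply: quot_proper_sub_max.
Qed.

Lemma coordinate_prime_variable (i : 'I_n) : coordinate_prime n (psX R (munit i)).
Proof.
apply/coordinate_prime_max; split; first exact: artinian_series_monomial.
rewrite /psX; case: eqP => [/ffunP /(_ i)|_]; last exact: (prime0 M_prime).
by rewrite !ffunE eqxx.
Qed.

Lemma maximal_ideal_generators : eqI Q (coordinate_prime n)
  (gen_ideal Q (fun f => exists i : 'I_n, f = psX R (munit i))).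
Proof.
have hm : is_ideal A (coordinate_prime n).
  by case: (coordinate_prime_prime R0 n M_prime n) => [[]].
split=> f hf; last first.
  apply: (hf (coordinate_prime n)) => [|_ [i ->]]; last exact: coordinate_prime_variable.
  by apply/quot_ideal; split=> //; apply: coordinate_prime_const.
move=> J /quot_ideal[hJ hMJ] hX.
have [s hs] := ideal_car hm hf.
pose L := [seq munit i | i <- enum 'I_n].
have hB := in_subalg_subring R0 s.
have munit_inj : injective (@munit n).
  move=> i j /ffunP /(_ i); rewrite !ffunE eqxx; by case: eqP.
have LE a : a \in L -> exists i, a = munit i by case/mapP => i _ ->; exists i.
(* Division by the variables: every nonconstant monomial is divisible by one, so only a constant
   remains, and it is in [M] because the remainder stays in the maximal ideal. *)
have [| | | |//|q [r [e [hqB hrB] hr _]]] := @power_series_division R n (in_subalg R0 s)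
    L (@psX R n) hB _ _ _ _ f.
- by rewrite map_inj_uniq // enum_uniq.
- by move=> a _; rewrite /psX eqxx.
- by move=> a b _; rewrite /psX; case: eqP => // ->; rewrite mlt_irr.
- move=> a b _; rewrite /psX; case: eqP => _; first exact: (subring1 hB).
  exact: (subring0 hB).
have hq a : S (q a) by exists s; apply: hqB.
rewrite e; apply: (idealD hJ).
  apply: (ideal_sum hJ) => a /LE[i ->]; apply: (idealM hJ) => //.
  by apply: hX; exists i.
apply: (ext_ideal_min hR0 artR0 hint M_prime hJ hMJ); first by exists s.
have /coordinate_prime_max[_ hr0] : coordinate_prime n r.
  rewrite (_ : r = (f : pser R n) - \sum_(a <- L) q a * psX R a); last first.
    by rewrite e addrAC subrr add0r.
  apply: (idealB hm) => //; apply: (ideal_sum hm) => a /LE[i ->].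
  by apply: (idealM hm) => //; apply: coordinate_prime_variable.
move=> m; case: (pselect (exists i, m i != 0%N)) => [[i hi]|hm0].
  rewrite (hr m (munit i)); first exact: (prime0 M_prime).
    by apply: map_f; rewrite mem_enum.
  by apply/mleP => j; rewrite ffunE; case: eqP => // ->; rewrite lt0n.
rewrite (_ : m = mone n) //; apply/ffunP => i; rewrite ffunE.
by apply/eqP; apply: contrapT => /negP hi; apply: hm0; exists i.
Qed.

Lemma const_prime (P : pser R n -> Prop) : is_prime A P ->
  is_prime (@ring_cr R (fun _ => True)) (fun r => P (psC r)).
Proof.
move=> [[hP hP1] hPM]; split; first split.
- split=> //= [x y _ -> //||x y hx hy|a x _ hx].
  + rewrite (_ : psC 0 = 0); first exact: ideal0 hP.
    by apply: funext => m; rewrite ps_coefC; case: eqP.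
  + by rewrite psCD; apply: (idealD hP).
  + by rewrite psCM; apply: (idealM hP) => //; apply: artinian_series_const.
- exact: hP1.
move=> a b _ _ /=; rewrite psCM => h.
by apply: hPM => //; apply: artinian_series_const.
Qed.

(** A prime inside [MS] contracts to a prime of [R] inside [M]. Elements outside that contraction
    are invertible modulo it, so it equals [M], and the given prime contains [MS]. *)
Lemma ext_ideal_minimal_prime : minimal_prime A (ext_ideal R0 M).
Proof.
have -> : ext_ideal R0 M = coordinate_prime 0.
  by apply: funext => f; apply: propext; apply: ext_ideal_coordinate.
split; first exact: coordinate_prime_prime.
move=> [P [hP [hPM [f [[hf hf'] hfP]]]]]; apply: hfP.
have hPc := const_prime hP.
apply: (ext_ideal_min hR0 artR0 hint M_prime) => //; first by case: hP => [[]].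
  move=> r hr; apply: contrapT => hrP.
  have [u hu] := prime_invertible hR0 artR0 hint hPc hrP.
  have [_ /(_ (mone n))] := hPM _ hu; rewrite -/(@psC R n (u * r - 1)) ps_coefC eqxx.
  move=> h; apply: (prime1 M_prime); rewrite -(subKr (u * r) 1).
  apply: (primeB M_prime); first exact: (primeM M_prime).
  by apply: h; apply: avoids_mone.
by move=> m; apply: hf' => j.
Qed.

Lemma quot_regular_local : regular_local Q.
Proof.
split; first exact: quot_noetherian.
exists (coordinate_prime n), n; split; first exact: quot_local.
split; first exact: quot_krull_dim.
exists (fun i => psX R (munit i)); split; last exact: maximal_ideal_generators.
by move=> i; apply: artinian_series_monomial.
Qed.

End Quotient.

Theorem theorem4p6 (R : comNzRingType) (R0 : R -> Prop) (n : nat) :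
  krull_dim (@ring_cr R (fun _ => True)) 0 ->
  subring_P R0 ->
  artinian (@ring_cr R R0) ->
  @integral_over R R0 ->
  krull_dim (@art_ps_ring R R0 n) n /\
  (forall M : R -> Prop, is_prime (@ring_cr R (fun _ => True)) M ->
     minimal_prime (@art_ps_ring R R0 n) (@ext_ideal R R0 n M) /\
     regular_local (@quot_cring R R0 n (@ext_ideal R R0 n M)) /\
     krull_dim (@quot_cring R R0 n (@ext_ideal R R0 n M)) n).
Proof.
move=> [[P0 [hP0 _]] _] hR0 artR0 hint; split; last first.
  move=> M hM; split; first exact: ext_ideal_minimal_prime.
  by split; [apply: quot_regular_local | apply: quot_krull_dim].
split.
  exists (@coordinate_prime R R0 n (P0 0%N)).
  exact: coordinate_prime_chain (hP0 0%N (leq0n _)).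
(* The constants in the least prime of an arbitrary chain form a prime of [R], which serves as the
   [M] of the length bound. *)
move=> [P hP]; have hP0' := hP.1 0%N (leq0n _).
exact: (no_long_prime_chain hR0 artR0 hint (const_prime hP0') (P := P)).
Qed.
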